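(* Let $n\ge 1$ and let $$\Theta=f_1(\underline z,w)\,dz_1+\cdots+f_n(\underline z,w)\,dz_n+g(\underline z,w)\,dw,\qquad f_1,\ldots,f_n,g\in\mathbb C\{\underline z,w\},$$ be a germ at $(\underline 0,0)\in\mathbb C^{n+1}$ of a not identically vanishing holomorphic $1$-form satisfying the integrability condition $\Theta\wedge d\Theta=0$, and let $\mathcal F$ be the germ of codimension one singular foliation it defines. Assume that $g(\underline 0,w)$ vanishes at order $k$ at $w=0$, with $k\in\mathbb N^*=\{1,2,\ldots\}$. Then, up to an analytic change of the $w$-coordinate $w:=\phi(\underline z,w)$, the foliation $\mathcal F$ is also defined by a $1$-form $$\widetilde\Theta=P_1(\underline z,w)\,dz_1+\cdots+P_n(\underline z,w)\,dz_n+Q(\underline z,w)\,dw$$ where $P_1,\ldots,P_n,Q\in\mathbb C\{\underline z\}[w]$ are polynomials in $w$ of degree $\le k$ and $Q$ is unitary (monic in $w$).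
   Context: The coordinates on $\mathbb C^{n+1}$ are $(\underline z,w)$ with $\underline z=(z_1,\ldots,z_n)$. $\mathbb C\{\underline z,w\}$ and $\mathbb C\{\underline z\}$ denote rings of convergent power series (germs of holomorphic functions at the origin). A $w$-polynomial is an element of $\mathbb C\{\underline z\}[w]$. An integrable $1$-form $\Theta\not\equiv 0$ defines a singular foliation whose leaves are tangent to $\ker\Theta$; after dividing the coefficients by a common factor, the zero set has codimension at least $2$ and the foliation is regular outside it. Two not identically vanishing integrable $1$-forms define the same foliation if they are proportional, i.e. differ by multiplication by a not identically zero germ of meromorphic function. An analytic change of the $w$-coordinate is a germ of biholomorphism of $(\mathbb C^{n+1},0)$ of the form $(\underline z,w)\mapsto(\underline z,\phi(\underline z,w))$, leaving $\underline z$ unchanged. *)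

(* Defs.v *)
(* [mpoly] has to be imported before the analysis files: the notations clash
   in the other order. *)
From HB Require Import structures.
From mathcomp Require Import all_boot all_order all_algebra.
From mathcomp Require Import mpoly.
From mathcomp Require Import complex.
From mathcomp Require Import classical_sets reals ereal esum.

Set Implicit Arguments.
Unset Strict Implicit.
Unset Printing Implicit Defensive.

Import Order.TTheory GRing.Theory Num.Theory.

Local Open Scope classical_set_scope.
Local Open Scope ring_scope.

(* A germ of holomorphic function at the origin of C^N is represented by its
   Taylor series [a], with [a m] the coefficient of the monomial [m]; the ring
   C{x_1, ..., x_N} consists of those [a] with [ps_convergent a]. *)
Definition mfps (R : realType) (N : nat) : Type := 'X_{1..N} -> R[i].

Section PowerSeries.
Variables (R : realType) (N : nat).
Implicit Types (a b : mfps R N) (m : 'X_{1..N}).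

Definition ps_convergent a : Prop :=
  exists2 r : R, 0 < r &
    (\esum_(m in [set: 'X_{1..N}])
        (Normc.normc (a m) * r ^+ mdeg m)%:E < +oo)%E.

Definition ps_zero : mfps R N := fun=> 0.

Definition ps_one : mfps R N := fun m => (m == 0%MM)%:R.

Definition ps_X (i : 'I_N) : mfps R N := fun m => (m == U_(i)%MM)%:R.

(* Same shape as [mcoeffM] for polynomials. *)
Definition ps_mul a b : mfps R N := fun m =>
  \sum_(k : 'X_{1..N < (mdeg m).+1, (mdeg m).+1} | m == (k.1 + k.2)%MM)
    a k.1 * b k.2.

Definition ps_exp a (e : nat) : mfps R N := iter e (ps_mul a) ps_one.

Definition ps_deriv (i : 'I_N) a : mfps R N := fun m =>
  a (m + U_(i))%MM *+ (m i).+1.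

End PowerSeries.

Arguments ps_zero {R N}.
Arguments ps_one {R N}.
Arguments ps_X {R N}.

(* Coefficient [m] of [f (Phi_1, ..., Phi_N)], for [Phi] without constant
   terms: then [\prod_i Phi_i ^ p_i] has order at least [mdeg p], so that only
   the monomials [p] with [mdeg p <= mdeg m] contribute. *)
Definition ps_comp (R : realType) (N M : nat) (f : mfps R N)
    (Phi : 'I_N -> mfps R M) : mfps R M := fun m =>
  \sum_(p : 'X_{1..N < (mdeg m).+1})
    f p * (\big[@ps_mul R M/ps_one]_(i < N) ps_exp (Phi i) (p i)) m.

Section Germs.
Variables (R : realType) (N : nat).
Implicit Types (Phi Psi Theta : 'I_N -> mfps R N).

(* Components of a germ of holomorphic map (C^N, 0) -> (C^N, 0). *)
Definition germ_map Phi : Prop :=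
  forall i, ps_convergent (Phi i) /\ Phi i 0%MM = 0.

Definition germ_biholomorphism Phi : Prop :=
  germ_map Phi /\
  exists Psi, germ_map Psi /\
    forall i, ps_comp (Phi i) Psi = ps_X i /\ ps_comp (Psi i) Phi = ps_X i.

(* The 1-form [\sum_i Theta_i dx_i] is represented by its coefficients. *)
Definition holomorphic_form Theta : Prop := forall i, ps_convergent (Theta i).

(* Coefficient of [d Theta] on [dx_i /\ dx_j]. *)
Definition form_d Theta (i j : 'I_N) : mfps R N :=
  ps_deriv i (Theta j) \- ps_deriv j (Theta i).

(* The coefficients of [Theta /\ d Theta] on all [dx_i /\ dx_j /\ dx_l]
   vanish. *)
Definition integrable_form Theta : Prop :=
  forall i j l,
    ps_mul (Theta i) (form_d Theta j l) \+
    ps_mul (Theta j) (form_d Theta l i) \+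
    ps_mul (Theta l) (form_d Theta i j) = ps_zero.

Definition form_pullback Phi Theta : 'I_N -> mfps R N := fun j m =>
  \sum_(i < N) ps_mul (ps_comp (Theta i) Phi) (ps_deriv j (Phi i)) m.

(* [Theta' = (a / b) Theta], [a / b] being a nonzero germ of meromorphic
   function. *)
Definition same_foliation Theta Theta' : Prop :=
  exists a b : mfps R N,
    [/\ ps_convergent a, ps_convergent b, a <> ps_zero, b <> ps_zero &
        forall i, ps_mul b (Theta' i) = ps_mul a (Theta i)].

End Germs.

(* The coordinates on C^(n+1) are z_1, ..., z_n followed by w, so that
   [ord_max : 'I_n.+1] is the index of w. *)
Section WCoordinate.
Variables (R : realType) (n : nat).
Implicit Types (a phi : mfps R n.+1).

Definition w_pow (j : nat) : 'X_{1..n.+1} := (U_(ord_max) *+ j)%MM.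

(* The germ (z, w) |-> (z, phi (z, w)). *)
Definition w_map phi : 'I_n.+1 -> mfps R n.+1 := fun i =>
  if i == ord_max then phi else ps_X i.

Definition w_order_at (k : nat) a : Prop :=
  (forall j, (j < k)%N -> a (w_pow j) = 0) /\ a (w_pow k) <> 0.

Definition w_degree_le (k : nat) a : Prop :=
  forall m : 'X_{1..n.+1}, (k < m ord_max)%N -> a m = 0.

Definition w_monic a : Prop :=
  exists d : nat, w_degree_le d a /\
    forall m : 'X_{1..n.+1}, m ord_max = d -> a m = (m == w_pow d)%:R.

End WCoordinate.

(* Main.v *)
(* Write [H = \sum_i z_i f_i / g] for the slope of the foliation along the Euler
   field [E = \sum_i z_i d/dz_i], expanded as a power series in z whose
   coefficients are Laurent series in w. A coordinate [w = phi (z, y)] with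
   [phi (0, y) = y] is chosen as the solution of the evolution equation
     [E phi = - phi_y * P_+ (H (z, phi) / phi_y)],
   where [P_+] keeps the powers of y of exponent at least 1; in this coordinate
   the radial slope only contains powers of y of exponent at most 0.
   Integrability propagates this to each slope [f_i / g], which is therefore
   holomorphic near y = oo. Weierstrass preparation makes [g] a monic polynomial
   Q of degree k up to a unit, and then the coefficients [Q * f_i / g] are both
   holomorphic at y = 0 and O (y^k) at y = oo: polynomials of degree at most k.

   The poles of the coefficient of z^m have order at most (k + 1) |m|, so the
   substitution [z_i = z'_i * w^(k+1)] turns all these Laurent expansions into
   ordinary power series in (z', w). The evolution equation loses one
   derivative, which integrating E recovers: it is solved in a ball of series
   majorized by [th * \sum_p xi^p / (p + 1)^3], [xi = A (z'_1 + ... + z'_n) + c w],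
   with A large. *)
Require Import Defs.
From HB Require Import structures.
From mathcomp Require Import all_boot all_order all_algebra.
From mathcomp Require Import mpoly complex.
From mathcomp Require Import boolp classical_sets cardinality fsbigop.
From mathcomp Require Import reals ereal esum.
From mathcomp Require Import zify ring lra.

Set Implicit Arguments.
Unset Strict Implicit.
Unset Printing Implicit Defensive.

Import Order.TTheory GRing.Theory Num.Theory.

Local Open Scope ring_scope.

(** * The ring of formal power series *)

Section SeriesRing.
Variables (R : realType) (N : nat).
Implicit Types (a b : mfps R N) (m : 'X_{1..N}).

(** Normalizing the n slopes at once would be an overdetermined system; the radial slope gives a
    single equation. Summing the integrability relations over j then expresses E of each slope
    through the radial one, with only lower z-degrees on the right.

    No annulus and no neighbourhood of y = oo occurs: holomorphy at 0 and at oo are conditions on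
    exponents ([inKp], [inKm]), and P_+ is diagonal with entries 0 and 1, so it cannot enlarge a
    majorant.

    The exponent k + 1 is what H / (y phi_y) asks for: g contributes w^k and y one more factor, so
    z_i f_i / (y g phi_y) becomes z'_i f_i over a unit.

    The evolution equation, the inverse of the coordinate change and the Weierstrass factor are
    treated alike: a map contracting for the order of vanishing has a formal fixed point, and
    coefficient bounds stable under the map pass from the iterates of 0 to that fixed point. In the
    evolution equation, th is fixed by the data and A is enlarged afterwards, the other bounds being
    independent of A. *)

Lemma mfpsP a b : (forall m, a m = b m) -> a = b.
Proof. by move=> h; apply: funext. Qed.

(** Congruence modulo the d-th power of the maximal ideal. The operations respect it (derivatives
    lose one degree) and every series is congruent to a polynomial, so identities are inherited from
    [{mpoly R[i][N]}] rather than proved on convolution sums. *)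
Record eqd (d : nat) a b : Prop :=
  Eqd { eqdE : forall m, (mdeg m < d)%N -> a m = b m }.

Lemma eqd_refl d a : eqd d a a. Proof. by []. Qed.

Lemma eqd_sym d a b : eqd d a b -> eqd d b a.
Proof. by case=> h; split=> m /h ->. Qed.

Lemma eqd_trans d b a (c : mfps R N) : eqd d a b -> eqd d b c -> eqd d a c.
Proof. by case=> h1 [h2]; split=> m hm; rewrite h1 // h2. Qed.

Lemma eqd_le d e a b : (e <= d)%N -> eqd d a b -> eqd e a b.
Proof. by move=> h [h1]; split=> m hm; apply: h1; apply: leq_trans hm h. Qed.

Lemma eqd_eq a b : (forall d, eqd d a b) -> a = b.
Proof. by move=> h; apply: mfpsP => m; apply: (eqdE (h (mdeg m).+1)). Qed.

Definition pol (p : {mpoly R[i][N]}) : mfps R N := fun m => p@_m.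

Definition trunc (d : nat) a : {mpoly R[i][N]} :=
  \sum_(m : 'X_{1..N < d}) (a m *: 'X_[m]).

Lemma eqd_trunc d a : eqd d a (pol (trunc d a)).
Proof. by split=> m hm; rewrite /pol /trunc mcoeff_mpoly. Qed.

Lemma eqd_mul d a a' b b' :
  eqd d a a' -> eqd d b b' -> eqd d (ps_mul a b) (ps_mul a' b').
Proof.
move=> ha hb; split=> m hm; rewrite /ps_mul; apply: eq_bigr => k /eqP km.
have := mdegD k.1 k.2; rewrite -km => e.
have h1 : (mdeg k.1 <= mdeg m)%N by rewrite [leqRHS]e leq_addr.
have h2 : (mdeg k.2 <= mdeg m)%N by rewrite [leqRHS]e leq_addl.
by rewrite (eqdE ha) ?(eqdE hb) //; apply: leq_ltn_trans hm.
Qed.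

Lemma pol_mul p q : pol (p * q) = ps_mul (pol p) (pol q).
Proof. by apply: mfpsP => m; rewrite /pol mcoeffM. Qed.

Lemma ps_mulC a b : ps_mul a b = ps_mul b a.
Proof.
apply: eqd_eq => d.
apply: eqd_trans (eqd_mul (eqd_trunc d a) (eqd_trunc d b)) _.
apply: eqd_sym; apply: eqd_trans (eqd_mul (eqd_trunc d b) (eqd_trunc d a)) _.
by rewrite -!pol_mul mulrC.
Qed.

Lemma ps_mulA a b (c : mfps R N) : ps_mul a (ps_mul b c) = ps_mul (ps_mul a b) c.
Proof.
apply: eqd_eq => d.
have [ha hb hc] := And3 (eqd_trunc d a) (eqd_trunc d b) (eqd_trunc d c).
apply: eqd_trans (eqd_mul ha (eqd_mul hb hc)) _.
apply: eqd_sym; apply: eqd_trans (eqd_mul (eqd_mul ha hb) hc) _.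
by rewrite -!pol_mul mulrA.
Qed.

Lemma pol1 : pol 1 = ps_one.
Proof. by apply: mfpsP => m; rewrite /pol /ps_one mcoeff1. Qed.

Lemma ps_mul1 a : ps_mul ps_one a = a.
Proof.
apply: eqd_eq => d; apply: eqd_trans (eqd_mul (@eqd_refl _ _) (eqd_trunc d a)) _.
by rewrite -pol1 -pol_mul mul1r; apply: eqd_sym; apply: eqd_trunc.
Qed.

Definition ps_add a b : mfps R N := fun m => a m + b m.
Definition ps_opp a : mfps R N := fun m => - a m.

Lemma ps_addA : associative ps_add.
Proof. by move=> a b c; apply: mfpsP => m; rewrite /ps_add addrA. Qed.

Lemma ps_addC : commutative ps_add.
Proof. by move=> a b; apply: mfpsP => m; rewrite /ps_add addrC. Qed.

Lemma ps_add0 : left_id ps_zero ps_add.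
Proof. by move=> a; apply: mfpsP => m; rewrite /ps_add add0r. Qed.

Lemma ps_addN : left_inverse ps_zero ps_opp ps_add.
Proof. by move=> a; apply: mfpsP => m; rewrite /ps_add addNr. Qed.

Lemma ps_mulDl : left_distributive (@ps_mul R N) ps_add.
Proof.
move=> a b c; apply: mfpsP => m; rewrite /ps_add /ps_mul -big_split /=.
by apply: eq_bigr => k _; rewrite mulrDl.
Qed.

HB.instance Definition _ := gen_eqMixin (mfps R N).
HB.instance Definition _ := gen_choiceMixin (mfps R N).
HB.instance Definition _ :=
  GRing.isZmodule.Build (mfps R N) ps_addA ps_addC ps_add0 ps_addN.

Lemma ps_one_neq : @ps_one R N != 0.
Proof.
apply/eqP => h; have := congr1 (fun f : mfps R N => f 0%MM) h.
by rewrite /ps_one eqxx => /eqP; rewrite oner_eq0.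
Qed.

HB.instance Definition _ := GRing.Zmodule_isComNzRing.Build (mfps R N)
  ps_mulA ps_mulC ps_mul1 ps_mulDl ps_one_neq.

Lemma psD a b m : (a + b) m = a m + b m. Proof. by []. Qed.
Lemma psN a m : (- a) m = - a m. Proof. by []. Qed.
Lemma psB a b m : (a - b) m = a m - b m. Proof. by []. Qed.
Lemma ps0 m : (0 : mfps R N) m = 0. Proof. by []. Qed.
Lemma ps1 m : (1 : mfps R N) m = (m == 0%MM)%:R. Proof. by []. Qed.
Lemma ps_mulE a b : ps_mul a b = a * b. Proof. by []. Qed.

Lemma ps_sumE I (r : seq I) (P : pred I) (F : I -> mfps R N) m :
  (\sum_(i <- r | P i) F i) m = \sum_(i <- r | P i) F i m.
Proof. by apply: (big_morph (fun f : mfps R N => f m)). Qed.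
Lemma ps_expE a e : ps_exp a e = a ^+ e.
Proof. by elim: e => [|e IH] //=; rewrite exprS -IH. Qed.
Lemma eqdD d a a' b b' : eqd d a a' -> eqd d b b' -> eqd d (a + b) (a' + b').
Proof. by move=> [h] [h']; split=> m hm; rewrite !psD h ?h'. Qed.

Lemma eqdN d a a' : eqd d a a' -> eqd d (- a) (- a').
Proof. by move=> [h]; split=> m hm; rewrite !psN h. Qed.

Lemma eqdM d a a' b b' : eqd d a a' -> eqd d b b' -> eqd d (a * b) (a' * b').
Proof. exact: eqd_mul. Qed.

Lemma eqdX d a a' e : eqd d a a' -> eqd d (a ^+ e) (a' ^+ e).
Proof. by move=> h; elim: e => [//|e IH]; rewrite !exprS; apply: eqdM. Qed.

Lemma eqd_sum d I (r : seq I) (P : pred I) (F G : I -> mfps R N) :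
  (forall i, P i -> eqd d (F i) (G i)) ->
  eqd d (\sum_(i <- r | P i) F i) (\sum_(i <- r | P i) G i).
Proof.
by move=> h; apply: (big_ind2 (eqd d)) => // *; apply: eqdD.
Qed.

Lemma eqd_prod d I (r : seq I) (P : pred I) (F G : I -> mfps R N) :
  (forall i, P i -> eqd d (F i) (G i)) ->
  eqd d (\prod_(i <- r | P i) F i) (\prod_(i <- r | P i) G i).
Proof.
by move=> h; apply: (big_ind2 (eqd d)) => // *; apply: eqdM.
Qed.

Lemma eqd1_0 a : a 0%MM = 0 -> eqd 1 a 0.
Proof. by move=> h; split=> m; rewrite ltnS leqn0 mdeg_eq0 => /eqP ->. Qed.

Lemma eqdM0 d e a b : eqd d a 0 -> eqd e b 0 -> eqd (d + e) (a * b) 0.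
Proof.
move=> [ha] [hb]; split=> m hm; rewrite -ps_mulE /ps_mul big1 ?ps0 //.
move=> k /eqP km; have e1 := mdegD k.1 k.2; rewrite -km in e1.
case: (ltnP (mdeg k.1) d) => h; first by rewrite ha // mul0r.
rewrite hb ?mulr0 //; rewrite ltnNge; apply/negP => h2.
by move: hm; rewrite ltnNge [leqRHS]e1 leq_add.
Qed.

(** Precision gained from a factor of positive order: the source of contraction in every fixed-point
    argument below. *)
Lemma eqdMl d e a b b' :
  eqd e a 0 -> eqd d b b' -> eqd (d + e) (a * b) (a * b').
Proof.
move=> ha hb; have : eqd d (b - b') 0.
  by rewrite -(subrr b'); apply: eqdD.
move=> /(eqdM0 ha); rewrite mulrBr addnC => -[h].
by split=> m /h; rewrite psB ps0 => /eqP; rewrite subr_eq0 => /eqP.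
Qed.

Lemma eqdX0 a e : a 0%MM = 0 -> eqd e (a ^+ e) 0.
Proof.
move=> h; elim: e => [|e IH]; first by split.
by rewrite exprS -add1n; apply: eqdM0 => //; apply: eqd1_0.
Qed.

Lemma eqd_prodX0 (K : finType) (F : K -> mfps R N) (e : K -> nat) :
  (forall i, F i 0%MM = 0) -> eqd (\sum_i e i) (\prod_i F i ^+ e i) 0.
Proof.
move=> h; apply: (big_ind2 (fun d a => eqd d a 0)) => //.
- by move=> ? ? ? ?; apply: eqdM0.
- by move=> i _; apply: eqdX0.
Qed.

Lemma psM0 a b : (a * b) 0%MM = a 0%MM * b 0%MM.
Proof.
rewrite -ps_mulE /ps_mul.
rewrite (eq_bigl (fun k => k == (bm0, bm0))) /=; last first.
  move=> k; rewrite eq_sym mnmD_eq0; case: k => k1 k2 /=.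
  by rewrite xpair_eqE -!val_eqE /=.
rewrite (big_pred1 (bm0, bm0)) //=.
Qed.

Definition cst (c : R[i]) : mfps R N := fun m => if m == 0%MM then c else 0.

Lemma cstM_coef c a m : (cst c * a) m = c * a m.
Proof.
have: eqd (mdeg m).+1 (cst c * a) (pol (c%:MP * trunc (mdeg m).+1 a)).
  rewrite pol_mul; apply: eqdM; last exact: eqd_trunc.
  split=> k _; rewrite /pol mcoeffC /cst eq_sym.
  by case: eqP; rewrite ?mulr1 ?mulr0.
move=> [->//]; rewrite /pol mcoeffCM; congr (_ * _).
by rewrite /trunc mcoeff_mpoly.
Qed.

Lemma cstD c c' : cst (c + c') = cst c + cst c'.
Proof. by apply: mfpsP => m; rewrite psD /cst; case: eqP => //; rewrite addr0. Qed.

Lemma cstN c : cst (- c) = - cst c.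
Proof. by apply: mfpsP => m; rewrite psN /cst; case: eqP => //; rewrite oppr0. Qed.

Lemma cst1 : cst 1 = 1.
Proof. by apply: mfpsP => m; rewrite ps1 /cst; case: eqP. Qed.

Lemma cst_zmod_morphism : zmod_morphism cst.
Proof. by move=> a b; rewrite cstD cstN. Qed.

Lemma cst_monoid_morphism : monoid_morphism cst.
Proof.
split=> [|a b]; first exact: cst1.
by apply: mfpsP => m; rewrite cstM_coef /cst; case: eqP => //; rewrite mulr0.
Qed.

HB.instance Definition _ :=
  GRing.isZmodMorphism.Build R[i] (mfps R N) cst cst_zmod_morphism.
HB.instance Definition _ :=
  GRing.isMonoidMorphism.Build R[i] (mfps R N) cst cst_monoid_morphism.

Lemma pol0 : pol 0 = 0.
Proof. by apply: mfpsP => m; rewrite /pol mcoeff0. Qed.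

Lemma polD p q : pol (p + q) = pol p + pol q.
Proof. by apply: mfpsP => m; rewrite psD /pol mcoeffD. Qed.

Lemma polZ c p : pol (c *: p) = cst c * pol p.
Proof. by apply: mfpsP => m; rewrite cstM_coef /pol mcoeffZ. Qed.

Lemma polM p q : pol (p * q) = pol p * pol q.
Proof. exact: pol_mul. Qed.

Lemma pol_X i : pol 'X_i = ps_X i.
Proof. by apply: mfpsP => m; rewrite /pol mcoeffX /ps_X eq_sym. Qed.

Lemma polXE m : pol 'X_[m] = \prod_i ps_X i ^+ m i.
Proof.
have polX p e : pol (p ^+ e) = pol p ^+ e.
  by elim: e => [|e IH]; rewrite ?expr0 ?pol1 // !exprS polM IH.
rewrite mpolyXE_id; rewrite (big_morph pol polM pol1).
by apply: eq_bigr => i _; rewrite polX pol_X.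
Qed.

Lemma psXE i m : (ps_X i : mfps R N) m = (m == U_(i)%MM)%:R. Proof. by []. Qed.

Lemma psXM_shift i a m : (ps_X i * a) (m + U_(i))%MM = a m.
Proof.
have: eqd (mdeg m).+2 (ps_X i * a) (pol (trunc (mdeg m).+2 a * 'X_[U_(i)])).
  by rewrite polM mulrC pol_X; apply: eqdM; [apply: eqd_trunc|].
move=> [->]; last by rewrite mdegD mdeg1 addn1.
rewrite /pol addmC mcoeffMX /trunc mcoeff_mpoly //.
Qed.

Lemma psXM_0 i a m : m i = 0%N -> (ps_X i * a) m = 0.
Proof.
move=> h; rewrite -ps_mulE /ps_mul big1 // => k /eqP km.
rewrite psXE; case: eqP => [e|]; rewrite ?mul0r //.
by have := congr1 (fun x : 'X_{1..N} => x i) km; rewrite /= h e mnmDE mnm1E eqxx.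
Qed.

Lemma psXM i a m :
  (ps_X i * a) m = if m i == 0%N then 0 else a (m - U_(i))%MM.
Proof.
case: eqP => [/psXM_0 //|/eqP h].
have {1}-> : m = (m - U_(i) + U_(i))%MM.
  rewrite submK //; apply/mnm_lepP => j.
  by rewrite mnm1E; case: eqP => // <-; rewrite lt0n.
exact: psXM_shift.
Qed.

Lemma psX_inj i : injective (fun a => ps_X i * a).
Proof.
move=> a b h; apply: mfpsP => m.
by rewrite -(psXM_shift i a) -(psXM_shift i b) h.
Qed.

End SeriesRing.

(** * Partial derivatives of power series *)

Section Deriv.
Variables (R : realType) (N : nat).
Implicit Types (a b : mfps R N) (i j : 'I_N).

Lemma eqd_deriv d i a b :
  eqd d.+1 a b -> eqd d (ps_deriv i a) (ps_deriv i b).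
Proof. by case=> h; split=> m hm; rewrite /ps_deriv h // mdegD mdeg1 addn1. Qed.

Lemma pol_deriv i p : pol (mderiv i p) = ps_deriv i (pol p) :> mfps R N.
Proof. by apply: mfpsP => m; rewrite /pol /ps_deriv mcoeff_deriv. Qed.

Lemma psderivD i a b : ps_deriv i (a + b) = ps_deriv i a + ps_deriv i b.
Proof. by apply: mfpsP => m; rewrite psD /ps_deriv psD mulrnDl. Qed.

Lemma psderivM i a b :
  ps_deriv i (a * b) = ps_deriv i a * b + a * ps_deriv i b.
Proof.
apply: eqd_eq => d; have [ha hb] := (eqd_trunc d.+1 a, eqd_trunc d.+1 b).
apply: eqd_trans (eqd_deriv _ (eqdM ha hb)) _.
apply: eqd_sym; apply: eqd_trans (eqdD (eqdM (eqd_deriv i ha) (eqd_le (leqnSn d) hb))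
  (eqdM (eqd_le (leqnSn d) ha) (eqd_deriv i hb))) _.
by rewrite -polM -!pol_deriv -!polM -polD mderivM.
Qed.

Lemma psderiv_comm i j a : ps_deriv i (ps_deriv j a) = ps_deriv j (ps_deriv i a).
Proof.
apply: mfpsP => m; rewrite /ps_deriv; have [->//|ij] := eqVneq i j.
rewrite !mnmDE !mnm1E (eq_sym j i) (negbTE ij) !addn0.
by rewrite -!mulrnA mulnC -!addmA (addmC U_(i)%MM).
Qed.

Lemma psderiv_X i j : ps_deriv i (ps_X j) = (i == j)%:R :> mfps R N.
Proof.
apply: mfpsP => m; rewrite /ps_deriv psXE.
have -> : (i == j)%:R = cst (i == j)%:R :> mfps R N by rewrite rmorph_nat.
rewrite /cst; case: (altP (m =P _)) => [->|m0].
  by rewrite add0m eq_mnm1 mnm0E.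
case: eqP => [e|_]; last by rewrite mul0rn.
case/negP: m0.
rewrite -mdeg_eq0; have := congr1 mdeg e; rewrite mdegD !mdeg1; lia.
Qed.

Lemma psderiv_cst i c : ps_deriv i (cst c) = 0 :> mfps R N.
Proof.
apply: mfpsP => m; rewrite /ps_deriv /cst.
case: eqP => [/(congr1 mdeg)|_]; last by rewrite mul0rn.
rewrite mdegD mdeg1 mdeg0; lia.
Qed.

End Deriv.

(** * Composition *)

Section Comp.
Variables (R : realType) (N M : nat).
Implicit Types (f g : mfps R N) (Phi : 'I_N -> mfps R M).

Definition nilp_map Phi : Prop := forall i, Phi i 0%MM = 0.

Lemma ps_compE f Phi m : ps_comp f Phi m =
  \sum_(p : 'X_{1..N < (mdeg m).+1}) f p * (\prod_i Phi i ^+ p i) m.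
Proof.
apply: eq_bigr => p _; congr (_ * _).
suff -> : \big[@ps_mul R M/ps_one]_(i < N) ps_exp (Phi i) (p i) =
  \prod_i Phi i ^+ p i by [].
by apply: eq_bigr => i _; rewrite ps_expE.
Qed.

Lemma eqd_comp d f g Phi Psi :
  eqd d f g -> (forall i, eqd d (Phi i) (Psi i)) ->
  eqd d (ps_comp f Phi) (ps_comp g Psi).
Proof.
move=> hf hP; split=> m hm; rewrite !ps_compE; apply: eq_bigr => p _.
rewrite (eqdE hf); last by apply: leq_trans (bmdeg p) hm.
congr (_ * _); suff [e] :
    eqd d (\prod_i Phi i ^+ p i) (\prod_i Psi i ^+ p i) by rewrite e.
by apply: eqd_prod => i _; apply: eqdX.
Qed.

Lemma pscomp_monomial0 Phi (p : 'X_{1..N}) m : nilp_map Phi ->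
  (mdeg m < mdeg p)%N -> (\prod_i Phi i ^+ p i) m = 0.
Proof.
move=> h hm; have [->] // := @eqd_prodX0 _ _ _ Phi p h.
by rewrite -mdegE.
Qed.

Lemma pscompD f g Phi : ps_comp (f + g) Phi = ps_comp f Phi + ps_comp g Phi.
Proof.
apply: mfpsP => m; rewrite psD !ps_compE -big_split /=.
by apply: eq_bigr => p _; rewrite psD mulrDl.
Qed.

Lemma pscompcM c f Phi : ps_comp (cst c * f) Phi = cst c * ps_comp f Phi.
Proof.
apply: mfpsP => m; rewrite cstM_coef !ps_compE mulr_sumr.
by apply: eq_bigr => p _; rewrite cstM_coef mulrA.
Qed.

Lemma pscomp0 Phi : ps_comp 0 Phi = 0.
Proof.
by apply: mfpsP => m; rewrite ps_compE big1 // => p _; rewrite ps0 mul0r.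
Qed.

Lemma pscomp_polX (q : 'X_{1..N}) Phi : nilp_map Phi ->
  ps_comp (pol 'X_[q]) Phi = \prod_i Phi i ^+ q i.
Proof.
move=> h; apply: mfpsP => m; rewrite ps_compE.
case: (ltnP (mdeg q) (mdeg m).+1) => hq; last first.
  rewrite pscomp_monomial0 // big1 // => p _; rewrite /pol mcoeffX.
  case: eqP => [e|]; last by rewrite mul0r.
  by have := bmdeg p; rewrite -e ltnNge hq.
rewrite (bigD1 (BMultinom hq)) //= /pol mcoeffX eqxx mul1r [X in _ + X]big1 ?addr0 //.
move=> p hp; rewrite mcoeffX; case: eqP => [e|_]; last by rewrite mul0r.
by case/negP: hp; rewrite bmeqP /= e.
Qed.

Lemma pscomp_pol (p : {mpoly R[i][N]}) Phi : nilp_map Phi ->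
  ps_comp (pol p) Phi = mmap (@cst R M) Phi p.
Proof.
move=> h; elim/mpolyind: p => [|c m p _ _ IH].
  by rewrite mmap0 pol0 pscomp0.
by rewrite polD polZ pscompD pscompcM IH pscomp_polX // mmapD mmapZ mmapX.
Qed.

Lemma pscompM f g Phi : nilp_map Phi ->
  ps_comp (f * g) Phi = ps_comp f Phi * ps_comp g Phi.
Proof.
move=> h; apply: eqd_eq => d; have [hf hg] := (eqd_trunc d f, eqd_trunc d g).
have eP i : eqd d (Phi i) (Phi i) by [].
apply: eqd_trans (eqd_comp (eqdM hf hg) eP) _.
apply: eqd_sym; apply: eqd_trans (eqdM (eqd_comp hf eP) (eqd_comp hg eP)) _.
by rewrite -polM !pscomp_pol // rmorphM.
Qed.

Lemma pscompC c Phi : ps_comp (cst c) Phi = cst c.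
Proof.
apply: mfpsP => m; rewrite ps_compE (bigD1 bm0) //= [X in _ + X]big1 ?addr0 => [|p hp].
  rewrite big1 => [|i _]; last by rewrite mnm0E expr0.
  by rewrite /cst eqxx ps1; case: eqP; rewrite ?mulr1 ?mulr0.
rewrite /cst; case: eqP => [e|_]; last by rewrite mul0r.
by case/negP: hp; rewrite bmeqP /= e.
Qed.

Lemma pscomp1 Phi : ps_comp 1 Phi = 1.
Proof. by rewrite -(cst1 R N) pscompC cst1. Qed.

Lemma pscompN f Phi : ps_comp (- f) Phi = - ps_comp f Phi.
Proof.
by apply/eqP; rewrite -subr_eq0 opprK -pscompD addNr pscomp0.
Qed.

Lemma pscompB f g Phi : ps_comp (f - g) Phi = ps_comp f Phi - ps_comp g Phi.
Proof. by rewrite pscompD pscompN. Qed.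

Lemma pscompXn f e Phi : nilp_map Phi ->
  ps_comp (f ^+ e) Phi = ps_comp f Phi ^+ e.
Proof.
by move=> h; elim: e => [|e IH]; rewrite ?expr0 ?pscomp1 // !exprS pscompM // IH.
Qed.

Lemma pscomp_sum I (r : seq I) (P : pred I) (F : I -> mfps R N) Phi :
  ps_comp (\sum_(i <- r | P i) F i) Phi = \sum_(i <- r | P i) ps_comp (F i) Phi.
Proof.
exact: (big_morph (fun f => ps_comp f Phi) (fun a b => pscompD a b Phi)
  (pscomp0 Phi)).
Qed.

Lemma pscomp_prod I (r : seq I) (P : pred I) (F : I -> mfps R N) Phi :
  nilp_map Phi ->
  ps_comp (\prod_(i <- r | P i) F i) Phi =
  \prod_(i <- r | P i) ps_comp (F i) Phi.
Proof.
move=> h; exact: (big_morph (fun f => ps_comp f Phi)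
  (fun a b => pscompM a b h) (pscomp1 Phi)).
Qed.

Lemma pscomp_X i Phi : nilp_map Phi -> ps_comp (ps_X i) Phi = Phi i.
Proof.
move=> h; rewrite -pol_X pscomp_pol // mmapX.
rewrite /mmap1 (bigD1 i) //= mnm1E eqxx expr1 big1 ?mulr1 // => j hj.
by rewrite mnm1E eq_sym (negbTE hj).
Qed.

Lemma pscomp_coef0 f Phi : nilp_map Phi -> (ps_comp f Phi) 0%MM = f 0%MM.
Proof.
move=> h; rewrite ps_compE (bigD1 bm0) //= [X in _ + X]big1 ?addr0 => [|p hp].
  by rewrite big1 ?ps1 ?eqxx ?mulr1 // => i _; rewrite mnm0E.
case/negP: hp; rewrite bmeqP /= -mdeg_eq0 -leqn0 -ltnS.
by apply: (leq_trans (bmdeg p)); rewrite mdeg0.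
Qed.

(** The series that satisfy the chain rule contain constants and coordinates and are stable under
    sums and products, which settles polynomials. A general f is truncated at order d + 1, one more
    than d because differentiation loses a degree. *)
Lemma psderiv_comp j f Phi : nilp_map Phi ->
  ps_deriv j (ps_comp f Phi) =
  \sum_i ps_comp (ps_deriv i f) Phi * ps_deriv j (Phi i).
Proof.
move=> h; apply: eqd_eq => d; have hf := eqd_trunc d.+1 f.
have eP i : eqd d.+1 (Phi i) (Phi i) by [].
have eP' i : eqd d (Phi i) (Phi i) by [].
apply: eqd_trans (eqd_deriv _ (eqd_comp hf eP)) _.
apply: eqd_sym; apply: (eqd_trans (b :=
    \sum_i ps_comp (ps_deriv i (pol (trunc d.+1 f))) Phi * ps_deriv j (Phi i))).
  by apply: eqd_sum => i _; apply: eqdM => //; apply: eqd_comp => //; apply: eqd_deriv.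
suff -> : ps_deriv j (ps_comp (pol (trunc d.+1 f)) Phi) =
  \sum_i ps_comp (ps_deriv i (pol (trunc d.+1 f))) Phi * ps_deriv j (Phi i) by [].
elim/mpolyind: (trunc d.+1 f) => [|c m p _ _ IH].
  have -> : pol (0 : {mpoly R[i][N]}) = cst 0 by rewrite rmorph0 pol0.
  rewrite pscompC psderiv_cst big1 // => i _; rewrite psderiv_cst pscomp0 mul0r //.
rewrite polD polZ polXE pscompD pscompcM psderivD IH.
pose C (g : mfps R N) := ps_deriv j (ps_comp g Phi) =
  \sum_i ps_comp (ps_deriv i g) Phi * ps_deriv j (Phi i).
have CM g1 g2 : C g1 -> C g2 -> C (g1 * g2).
  rewrite /C => h1 h2; rewrite pscompM // psderivM h1 h2 mulr_suml mulr_sumr -big_split /=.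
  by apply: eq_bigr => i _; rewrite psderivM pscompD !pscompM //; ring.
have Cc c' : C (cst c').
  by rewrite /C pscompC psderiv_cst big1 // => i _; rewrite psderiv_cst pscomp0 mul0r.
have CX i : C (ps_X i).
  rewrite /C pscomp_X // (bigD1 i) //= psderiv_X eqxx pscomp1 mul1r.
  by rewrite big1 ?addr0 // => k hk; rewrite psderiv_X (negbTE hk) pscomp0 mul0r.
have C1 : C 1 by rewrite -(cst1 R N).
have Cm : C (cst c * \prod_i ps_X i ^+ m i).
  apply: (CM); first exact: Cc.
  apply: (big_ind C); [exact: C1|exact: (CM)|move=> i _].
  by elim: (m i) => [|e IHe]; rewrite ?expr0 // exprS; apply: (CM) => //; apply: CX.
rewrite -pscompcM Cm -big_split /=; apply: eq_bigr => i _.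
by rewrite psderivD pscompD mulrDl.
Qed.

End Comp.

Lemma pscompA (R : realType) (N M L : nat) (f : mfps R N)
    (Phi : 'I_N -> mfps R M) (Psi : 'I_M -> mfps R L) :
  nilp_map Phi -> nilp_map Psi ->
  ps_comp (ps_comp f Phi) Psi = ps_comp f (fun i => ps_comp (Phi i) Psi).
Proof.
move=> h h'; apply: eqd_eq => d; have hf := eqd_trunc d f.
have h2 : nilp_map (fun i => ps_comp (Phi i) Psi) by move=> i; rewrite pscomp_coef0.
have e1 : eqd d (ps_comp f Phi) (ps_comp (pol (trunc d f)) Phi) by apply: eqd_comp.
apply: eqd_trans (eqd_comp e1 (fun i => @eqd_refl _ _ d (Psi i))) _.
have e2 := eqd_comp hf (fun i => @eqd_refl _ _ d (ps_comp (Phi i) Psi)).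
apply: eqd_sym; apply: eqd_trans e2 _.
suff -> : ps_comp (ps_comp (pol (trunc d f)) Phi) Psi =
  ps_comp (pol (trunc d f)) (fun i => ps_comp (Phi i) Psi) by [].
rewrite !pscomp_pol //; elim/mpolyind: (trunc d f) => [|c m p _ _ IH].
  by rewrite !mmap0 pscomp0.
rewrite !mmapD !mmapZ pscompD pscompcM IH !mmapX /mmap1 pscomp_prod //.
by congr (_ * _ + _); apply: eq_bigr => i _; rewrite pscompXn.
Qed.

Lemma pscomp_id (R : realType) (N : nat) (f : mfps R N) : ps_comp f ps_X = f.
Proof.
have h : nilp_map (@ps_X R N) by move=> i; rewrite psXE eq_sym mnm1_eq0.
apply: eqd_eq => d; have hf := eqd_trunc d f.
apply: eqd_trans (eqd_comp hf (fun i => @eqd_refl _ _ d (ps_X i))) _.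
apply: eqd_sym; apply: eqd_trans hf _.
suff -> : ps_comp (pol (trunc d f)) ps_X = pol (trunc d f) by [].
elim/mpolyind: (trunc d f) => [|c m p _ _ IH].
  by rewrite pol0 pscomp0.
by rewrite polD polZ pscompD pscompcM IH pscomp_polX // polXE.
Qed.

(** * Contractions for the order of vanishing *)

Section FixedPoint.
Variables (R : realType) (N : nat).
Implicit Types (a b c y i j : mfps R N).

Definition contracting (Psi : mfps R N -> mfps R N) : Prop :=
  (forall a, a 0%MM = 0 -> Psi a 0%MM = 0) /\
  forall d a b, a 0%MM = 0 -> b 0%MM = 0 ->
    eqd d a b -> eqd d.+1 (Psi a) (Psi b).

(** The iterates of 0 stabilize degree by degree, so each coefficient of the fixed point is a
    coefficient of some iterate; hence the last clause. It turns a formal solution into a convergent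
    one: take for [Q] a coefficient bound stable under [Psi]. *)
Lemma contracting_fixpoint Psi : contracting Psi ->
  exists a, [/\ a 0%MM = 0, Psi a = a &
    forall Q : 'X_{1..N} -> R[i] -> Prop,
      (forall m, Q m 0) ->
      (forall b, b 0%MM = 0 -> (forall m, Q m (b m)) ->
        forall m, Q m (Psi b m)) ->
      forall m, Q m (a m)].
Proof.
move=> [P0 Pc]; pose u d := iter d Psi 0.
have u0 d : u d 0%MM = 0 by elim: d => [|d IH] //=; apply: P0.
have uS d e : eqd d (u d) (u (d + e)%N).
  elim: d => [|d IH]; first by split.
  by rewrite addSn /u !iterS; apply: Pc => //; apply: u0.
pose a : mfps R N := fun m => u (mdeg m).+1 m.
have ua d : eqd d a (u d).
  by split=> m hm; rewrite /a (eqdE (uS _ (d - (mdeg m).+1)%N)) // subnKC.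
exists a; split.
- exact: u0.
- apply: eqd_eq => -[|d]; first by split.
  have a0 : a 0%MM = 0 by apply: u0.
  apply: eqd_trans (Pc _ _ _ a0 (u0 d) (ua d)) _.
  exact: eqd_sym (ua d.+1).
- move=> Q Q0 QP m; rewrite /a; move: (mdeg m).+1 => d.
  elim: d m => [|d IH] m //.
  by rewrite /u iterS; apply: QP => //; apply: u0.
Qed.

Lemma contracting_unique Psi a b : contracting Psi ->
  a 0%MM = 0 -> b 0%MM = 0 -> Psi a = a -> Psi b = b -> a = b.
Proof.
move=> [_ Pc] a0 b0 ea eb; apply: eqd_eq; elim=> [|d IH]; first by split.
by rewrite -ea -eb; apply: Pc.
Qed.

(** Total by a default value: 0 when a is not invertible. *)
Definition psinv a : mfps R N := xget 0 [set i | a * i = 1]%classic.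

(** The fixed point is y / (1 - y), the geometric series without its constant term; inverses are
    thus obtained together with estimates. *)
Lemma contracting_geom y : y 0%MM = 0 -> contracting (fun j => y * (1 + j)).
Proof.
move=> y0; split=> [a _|d a b _ _ h]; first by rewrite psM0 y0 mul0r.
by rewrite -[d.+1]addn1; apply: eqdMl; [apply: eqd1_0|apply: eqdD].
Qed.

Lemma psinv_uniq a i : a * i = 1 -> psinv a = i.
Proof.
move=> ai; have : a * psinv a = 1.
  by rewrite /psinv; case: xgetP => [j -> //|/(_ i) []].
by move=> aj; rewrite -[RHS]mul1r -aj [_ * psinv a]mulrC -mulrA ai mulr1.
Qed.

Lemma psinv_geomE y j : y 0%MM = 0 -> y * (1 + j) = j -> psinv (1 - y) = 1 + j.
Proof. by move=> y0 e; apply: psinv_uniq; rewrite mulrBl mul1r e addrK. Qed.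

Lemma psinvP a : a 0%MM != 0 -> a * psinv a = 1.
Proof.
move=> a0; pose y := 1 - cst (a 0%MM)^-1 * a.
have y0 : y 0%MM = 0 by rewrite /y psB ps1 eqxx cstM_coef mulVf // subrr.
have [j [_ ej _]] := contracting_fixpoint (contracting_geom y0).
have e : cst (a 0%MM)^-1 * a * (1 + j) = 1.
  have -> : cst (a 0%MM)^-1 * a = 1 - y by rewrite /y opprB addrC subrK.
  by rewrite mulrBl mul1r ej addrK.
by rewrite (@psinv_uniq a (cst (a 0%MM)^-1 * (1 + j))) mulrA ?[a * _]mulrC.
Qed.

Lemma eqd_inv d a b : a 0%MM != 0 -> b 0%MM != 0 -> eqd d a b ->
  eqd d (psinv a) (psinv b).
Proof.
move=> a0 b0 h.
have -> : psinv a = psinv b + psinv a * psinv b * (b - a).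
  have [ea eb] := (psinvP a0, psinvP b0).
  rewrite mulrBr -!mulrA [psinv b * b]mulrC eb mulr1.
  by rewrite [psinv b * a]mulrC mulrA [psinv a * a]mulrC ea mul1r addrC subrK.
rewrite -[X in eqd d _ X]addr0 -(mulr0 (psinv a * psinv b)) -(subrr b).
by apply: eqdD => //; apply: eqdM => //; apply: eqdD => //; apply: eqdN.
Qed.

Lemma psinv0 a : a 0%MM != 0 -> psinv a 0%MM = (a 0%MM)^-1.
Proof.
move=> h; have /(congr1 (fun f : mfps R N => f 0%MM)) := psinvP h.
rewrite psM0 ps1 eqxx => e; apply: (mulfI h); by rewrite e divff.
Qed.

Lemma unit_cancel a b c : a 0%MM != 0 -> a * b = a * c -> b = c.
Proof.
move=> h e; rewrite -[b]mul1r -[c]mul1r -(psinvP h) [a * _]mulrC.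
by rewrite -!mulrA e.
Qed.

(** Operators diagonal in the monomials: the fields x_i d/dx_i, the Euler field and its inverse, and
    the projections onto sets of exponents. Unlike plain derivatives they never lower the order of
    vanishing. *)
Definition dg (k : 'X_{1..N} -> R[i]) a : mfps R N := fun m => k m * a m.

Lemma dgD k a b : dg k (a + b) = dg k a + dg k b.
Proof. by apply: mfpsP => m; rewrite /dg !psD mulrDr. Qed.

Lemma dg0 k : dg k 0 = 0.
Proof. by apply: mfpsP => m; rewrite /dg !ps0 mulr0. Qed.

Lemma dg_sum k I (r : seq I) (P : pred I) (F : I -> mfps R N) :
  dg k (\sum_(i <- r | P i) F i) = \sum_(i <- r | P i) dg k (F i).
Proof. exact: (big_morph (dg k) (dgD k) (dg0 k)). Qed.

Lemma eqd_dg d k a b : eqd d a b -> eqd d (dg k a) (dg k b).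
Proof. by move=> [h]; split=> m hm; rewrite /dg h. Qed.

Lemma dgM k a b : (forall m1 m2, k (m1 + m2)%MM = k m1 + k m2) ->
  dg k (a * b) = dg k a * b + a * dg k b.
Proof.
move=> hk; apply: mfpsP => m; rewrite psD /dg -!ps_mulE /ps_mul -big_split /=.
rewrite mulr_sumr; apply: eq_bigr => p /eqP e.
by rewrite [X in k X]e hk; ring.
Qed.

Lemma dg_X k (i : 'I_N) : dg k (ps_X i) = cst (k U_(i)%MM) * ps_X i.
Proof.
apply: mfpsP => m; rewrite cstM_coef /dg psXE.
by case: eqP => [->//|_]; rewrite !mulr0.
Qed.

Lemma X_deriv (i : 'I_N) a : ps_X i * ps_deriv i a = dg (fun m => (m i)%:R) a.
Proof.
apply: mfpsP => m; rewrite psXM /dg; case: eqP => [->|/eqP h].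
  by rewrite mul0r.
have le : (U_(i) <= m)%MM.
  by apply/mnm_lepP => j; rewrite mnm1E; case: eqP => // <-; rewrite lt0n.
rewrite /ps_deriv submK // mnmBE mnm1E eqxx subn1 prednK ?lt0n //.
by rewrite mulr_natl.
Qed.

End FixedPoint.

(** * Laurent series in blown-up coordinates *)

Section BlowUp.
Variables (R : realType) (n : nat) (C : nat).
Local Notation w := (ord_max : 'I_n.+1).
Implicit Types (a b f s : mfps R n.+1) (m p : 'X_{1..n.+1}).

Definition zdeg m : nat := \sum_(i | i != w) m i.

Lemma zdegD m p : zdeg (m + p)%MM = (zdeg m + zdeg p)%N.
Proof. by rewrite -big_split /=; apply: eq_bigr => i _; rewrite mnmDE. Qed.

Lemma zdeg0 : zdeg 0%MM = 0%N.
Proof. by rewrite /zdeg big1 // => i _; rewrite mnm0E. Qed.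

Lemma mdeg_zdeg m : mdeg m = (zdeg m + m w)%N.
Proof. by rewrite mdegE (bigD1 w) //= addnC. Qed.

Lemma zdegU i : zdeg U_(i) = (i != w).
Proof.
have := mdeg_zdeg U_(i); rewrite mdeg1 mnm1E; case: eqP => _ /=; lia.
Qed.

(* [bl s] is the germ (z, w) |-> (z w^C, w (1 + s)). *)
Definition bl s : 'I_n.+1 -> mfps R n.+1 := fun i =>
  if i == w then ps_X w * (1 + s) else ps_X i * ps_X w ^+ C.

Lemma psX0 i : (ps_X i : mfps R n.+1) 0%MM = 0.
Proof. by rewrite psXE eq_sym mnm1_eq0. Qed.

Lemma bl_nilp s : nilp_map (bl s).
Proof. by move=> i; rewrite /bl; case: eqP; rewrite psM0 psX0 mul0r. Qed.

Lemma bl_w s : bl s w = ps_X w * (1 + s). Proof. by rewrite /bl eqxx. Qed.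

Lemma bl_z s i : i != w -> bl s i = ps_X i * ps_X w ^+ C.
Proof. by rewrite /bl => /negbTE ->. Qed.

Lemma eqd_bl d s s' i : eqd d s s' -> eqd d.+1 (bl s i) (bl s' i).
Proof.
rewrite /bl; case: eqP => // _ h; rewrite -[d.+1]addn1; apply: eqdMl.
  by apply: eqd1_0; rewrite psX0.
exact: eqdD.
Qed.

(* [beta] embeds power series in (z, w) into the series in (z', w) with
   z = z' w^C; there, the monomial m stands for z^m w^(m w - C * zdeg m).
   [raise] and [lower] are the corresponding changes of exponents. *)
Definition beta f : mfps R n.+1 := ps_comp f (bl 0).

Definition raise m : 'X_{1..n.+1} :=
  [multinom if i == w then (m i + C * zdeg m)%N else m i | i < n.+1].
Definition lower m : 'X_{1..n.+1} :=
  [multinom if i == w then (m i - C * zdeg m)%N else m i | i < n.+1].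

Lemma zdeg_raise m : zdeg (raise m) = zdeg m.
Proof. by apply: eq_bigr => i /negbTE h; rewrite mnmE h. Qed.
Lemma zdeg_lower m : zdeg (lower m) = zdeg m.
Proof. by apply: eq_bigr => i /negbTE h; rewrite mnmE h. Qed.
Lemma raise_w m : raise m w = (m w + C * zdeg m)%N.
Proof. by rewrite mnmE eqxx. Qed.
Lemma lower_w m : lower m w = (m w - C * zdeg m)%N.
Proof. by rewrite mnmE eqxx. Qed.

Lemma raiseK m : lower (raise m) = m.
Proof.
apply/mnmP => i; rewrite mnmE zdeg_raise mnmE; case: eqP => // _.
by rewrite addnK.
Qed.

Lemma lowerK m : (C * zdeg m <= m w)%N -> raise (lower m) = m.
Proof.
move=> h; apply/mnmP => i; rewrite mnmE zdeg_lower mnmE.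
by case: eqP => // ->; rewrite subnK.
Qed.

Lemma bl0_monomial m : \prod_i bl 0 i ^+ m i = pol 'X_[raise m].
Proof.
rewrite polXE (bigD1 w) // [RHS](bigD1 w) //= bl_w addr0 mulr1 raise_w exprD.
rewrite -mulrA; congr (_ * _).
rewrite (eq_bigr (fun i => ps_X i ^+ m i * ps_X w ^+ (C * m i)%N)); last first.
  by move=> i hi; rewrite bl_z // exprMn exprM.
rewrite big_split /= -expr_sum -big_distrr /= mulrC; congr (_ * _).
by apply: eq_bigr => i /negbTE h; rewrite mnmE h.
Qed.

Lemma beta_coef f m :
  beta f m = if (C * zdeg m <= m w)%N then f (lower m) else 0.
Proof.
rewrite /beta ps_compE.
have E p : (\prod_i bl 0 i ^+ p i) m = (raise p == m)%:R.
  by rewrite bl0_monomial /pol mcoeffX.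
case: leqP => h; last first.
  rewrite big1 // => p _; rewrite E; case: eqP => [e|]; rewrite ?mulr0 //.
  have := congr1 (fun x : 'X_{1..n.+1} => (x w < C * zdeg x)%N) e.
  by rewrite /= h raise_w zdeg_raise ltnNge leq_addl.
have hl : (mdeg (lower m) < (mdeg m).+1)%N.
  by rewrite ltnS !mdeg_zdeg zdeg_lower lower_w; lia.
rewrite (bigD1 (BMultinom hl)) //= E lowerK // eqxx mulr1 big1 ?addr0 //.
move=> p hp; rewrite E; case: eqP => [e|]; rewrite ?mulr0 //.
by case/negP: hp; rewrite bmeqP /=; apply/eqP; have := congr1 lower e; rewrite raiseK.
Qed.

(** Left inverse of [beta], and a true inverse on [inKp]; coefficients outside the range of [raise]
    are dropped. *)
Definition gamma a : mfps R n.+1 := fun m => a (raise m).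

(* Only nonnegative, resp. only negative, powers of w. *)
Definition inKp a : Prop := forall m, (m w < C * zdeg m)%N -> a m = 0.
Definition inKm a : Prop := forall m, (C * zdeg m <= m w)%N -> a m = 0.

Lemma gammaK a : inKp a -> beta (gamma a) = a.
Proof.
move=> h; apply: mfpsP => m; rewrite beta_coef; case: leqP => hm.
  by rewrite /gamma lowerK.
by rewrite h.
Qed.

Lemma betaK f : gamma (beta f) = f.
Proof.
apply: mfpsP => m; rewrite /gamma beta_coef zdeg_raise raise_w leq_addl.
by rewrite raiseK.
Qed.

Lemma beta_inKp f : inKp (beta f).
Proof. by move=> m h; rewrite beta_coef leqNgt h. Qed.

Lemma betaM f a : beta (f * a) = beta f * beta a.
Proof. exact: pscompM (bl_nilp 0). Qed.

Lemma betaD f a : beta (f + a) = beta f + beta a.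
Proof. exact: pscompD. Qed.

Lemma inKmM a b : inKm a -> inKm b -> inKm (a * b).
Proof.
move=> ha hb m hm; rewrite -ps_mulE /ps_mul big1 // => k /eqP e.
case: (leqP (C * zdeg k.1) ((k.1 : 'X_{1..n.+1}) w)) => h1.
  by rewrite ha ?mul0r.
rewrite hb ?mulr0 //.
have := congr1 zdeg e; have := congr1 (fun x : 'X_{1..n.+1} => x w) e.
rewrite /= zdegD mnmDE => e1 e2.
move: hm; rewrite [X in (C * X)%N]e2 [leqRHS]e1 mulnDr => hm.
move: hm h1; move: (C * zdeg k.1)%N (C * zdeg k.2)%N => x y.
by move: (fun_of_multinom k.1 w) (fun_of_multinom k.2 w) => u v; lia.
Qed.

Lemma inKmD a b : inKm a -> inKm b -> inKm (a + b).
Proof. by move=> ha hb m hm; rewrite psD ha ?hb ?addr0. Qed.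

Lemma inKm_dg k a : inKm a -> inKm (dg k a).
Proof. by move=> ha m hm; rewrite /dg ha ?mulr0. Qed.

(** The exponent of w carried by the monomial m is m w - C * zdeg m, so this is the projection onto
    exponents at least 0, the constant one included. *)
Definition Pp a : mfps R n.+1 := dg (fun m => (C * zdeg m <= m w)%N%:R) a.

Lemma Pp_inKp a : inKp (Pp a).
Proof. by move=> m h; rewrite /Pp /dg leqNgt h mul0r. Qed.

Lemma Pm_inKm a : inKm (a - Pp a).
Proof. by move=> m h; rewrite psB /Pp /dg h mul1r subrr. Qed.

(* In the blown-up coordinates these are the operators z_i d/dz_i,
   w d/dw and the Euler field in z. *)
Definition Di i a := dg (fun m => (m i)%:R) a.
Definition Dw a := dg (fun m => (m w)%:R - (C * zdeg m)%N%:R) a.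
Definition De a := dg (fun m => (zdeg m)%:R) a.

Lemma DwM a b : Dw (a * b) = Dw a * b + a * Dw b.
Proof. by apply: dgM => m p; rewrite mnmDE zdegD mulnDr !natrD; ring. Qed.

Lemma De_sum a : De a = \sum_(i | i != w) Di i a.
Proof.
apply: mfpsP => m; rewrite ps_sumE /De /Di /dg -mulr_suml; congr (_ * _).
by rewrite -natr_sum.
Qed.

Lemma beta_Di i f : i != w -> beta (Di i f) = Di i (beta f).
Proof.
move=> /negbTE h; apply: mfpsP => m; rewrite /Di /dg !beta_coef.
by case: leqP => _; rewrite ?mulr0 // mnmE h.
Qed.

Lemma beta_Dw f : beta (dg (fun m => (m w)%:R) f) = Dw (beta f).
Proof.
apply: mfpsP => m; rewrite /Dw /dg !beta_coef.
by case: leqP => h; rewrite ?mulr0 // lower_w natrB.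
Qed.

Lemma w_coef_monomial a m j :
  (ps_X w ^+ j * a) m = if (j <= m w)%N then a (m - w_pow n j)%MM else 0.
Proof.
elim: j m => [|j IH] m.
  rewrite expr0 mul1r leq0n; congr (a _); apply/mnmP => i.
  by rewrite mnmBE /w_pow mulmnE muln0 subn0.
rewrite exprS -mulrA psXM; case: eqP => [->//|/eqP h].
rewrite IH mnmBE mnm1E eqxx.
have -> : (j <= m w - true)%N = (j < m w)%N by move: (m w) h => u h /=; lia.
case: ifP => // _; congr (a _); apply/mnmP => i.
by rewrite !mnmBE /w_pow !mulmnE mulnS subnDA.
Qed.

End BlowUp.

(** * Convergence *)

Section Summability.
Variables (R : realType) (N : nat).
Implicit Types (f : mfps R N).
Local Notation nc := Normc.normc.

Lemma nc_ge0 (x : R[i]) : 0 <= nc x.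
Proof. by case: x => a b /=; exact: sqrtr_ge0. Qed.

Lemma nc0 : nc (0 : R[i]) = 0. Proof. exact: Normc.normc0. Qed.
Lemma nc1 : nc (1 : R[i]) = 1. Proof. exact: Normc.normc1. Qed.

Lemma nc_nat k : nc (k%:R : R[i]) = k%:R.
Proof.
have -> : (k%:R : R[i]) = (k%:R : R)%:C%C by rewrite rmorph_nat.
by rewrite /= expr0n addr0 sqrtr_sqr ger0_norm.
Qed.

Lemma ncD (x y : R[i]) : nc (x + y) <= nc x + nc y.
Proof. exact: (@le_normcD R x y). Qed.

Lemma ncN (x : R[i]) : nc (- x) = nc x.
Proof. exact: (@normcN R x). Qed.

Lemma nc_sum I (r : seq I) (P : pred I) (F : I -> R[i]) :
  nc (\sum_(i <- r | P i) F i) <= \sum_(i <- r | P i) nc (F i).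
Proof.
apply: (big_ind2 (fun x y => nc x <= y)) => //; first by rewrite nc0.
move=> x1 x2 y1 y2 h1 h2; apply: le_trans (ncD _ _) _.
exact: lerD.
Qed.

(** Finite partial sums replace the extended-real sum of [ps_convergent]; [convergent_sum_le] and
    [geometric_convergent] are the passages between the two. *)
Definition sum_le f (r M : R) : Prop :=
  forall D, \sum_(p : 'X_{1..N < D}) nc (f p) * r ^+ mdeg p <= M.

Lemma convergent_sum_le f : ps_convergent f ->
  exists r M, [/\ 0 < r, 0 < M & sum_le f r M].
Proof.
case=> r r0; set S := esum _ _ => Sfin.
have S0 : (0 <= S)%E.
  by apply: esum_ge0 => m _; rewrite lee_fin mulr_ge0 ?nc_ge0 ?exprn_ge0 ?ltW.
exists r, (fine S + 1); split=> //.
  by rewrite ltr_wpDl ?fine_ge0.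
move=> D; rewrite -lee_fin; apply: (@le_trans _ _ S); last first.
  by rewrite EFinD fineK ?ge0_fin_numE // leeDl.
apply: esum_ge; exists [set` map (@bmnm N D) (enum {: 'X_{1..N < D}})]%classic.
  by split; [exact: finite_seq|move=> ? _].
rewrite -fsbig_seq; last by rewrite map_inj_uniq ?enum_uniq //; exact: val_inj.
by rewrite big_map -sumEFin big_enum.
Qed.

(** Monomials of degree below D embed into N-tuples of exponents at most D, and the sum over all
    tuples factors into N geometric sums, each at most 2. *)
Lemma sum_geometric (x : R) D : 0 <= x -> x <= 1 / 2 ->
  \sum_(p : 'X_{1..N < D}) x ^+ mdeg p <= 2 ^+ N.
Proof.
move=> x0 x1; pose h (p : 'X_{1..N < D}) : {ffun 'I_N -> 'I_D.+1} :=
  [ffun i => inord (p i)].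
have hle (p : 'X_{1..N < D}) i : (p i < D.+1)%N.
  rewrite ltnS; apply: leq_trans (ltnW (bmdeg p)).
  by rewrite mdegE (bigD1 i) //= leq_addr.
have hi : injective h.
  move=> p q /ffunP e; apply: val_inj => /=; apply/mnmP => i.
  by have := e i; rewrite !ffunE => /(congr1 (@nat_of_ord _)); rewrite !inordK.
apply: (@le_trans _ _ (\sum_(t : {ffun 'I_N -> 'I_D.+1}) \prod_i x ^+ t i)).
  rewrite (eq_bigr (fun p => \prod_i x ^+ h p i)); last first.
    move=> p _; rewrite mdegE expr_sum; apply: eq_bigr => i _.
    by rewrite ffunE inordK.
  rewrite -(big_imset (fun t : {ffun 'I_N -> 'I_D.+1} => \prod_i x ^+ t i)) /=; last first.
    by move=> p q _ _; apply: hi.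
  rewrite [leRHS](bigID (mem [set h p | p in predT])) /= lerDl.
  by apply: sumr_ge0 => t _; apply: prodr_ge0 => i _; rewrite exprn_ge0.
rewrite -(bigA_distr_bigA (fun _ (j : 'I_D.+1) => x ^+ j)) /=.
rewrite -[X in _ <= _ ^+ X](card_ord N) -prodr_const.
apply: ler_prod => i _; apply/andP; split.
  by apply: sumr_ge0 => j _; rewrite exprn_ge0.
have := subrX1 x D.+1; set s := \sum_(j < _) _ => e.
have : 0 <= x ^+ D.+1 by rewrite exprn_ge0.
have s0 : 0 <= s by apply: sumr_ge0 => j _; rewrite exprn_ge0.
by nra.
Qed.

(** At radius 1 / (2 K) the terms are at most M (1/2)^|m|, and a finite set of monomials lies below
    some degree. *)
Lemma geometric_convergent f (M K : R) : 0 < K ->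
  (forall m, nc (f m) <= M * K ^+ mdeg m) -> ps_convergent f.
Proof.
move=> K0 h; exists (K^-1 / 2); first by rewrite divr_gt0 ?invr_gt0.
have M0 : 0 <= M.
  by have := h 0%MM; rewrite mdeg0 expr0 mulr1; apply: le_trans; apply: nc_ge0.
pose r := K^-1 / 2; have r0 : 0 < r by rewrite divr_gt0 ?invr_gt0.
apply: (@le_lt_trans _ _ (M * 2 ^+ N)%:E); last by rewrite ltry.
apply: ge_ereal_sup => /= ? -[A _ <-].
rewrite -/r sumEFin lee_fin.
set s := (X in \sum_(_ <- X) _).
pose D := (\max_(m <- s) (mdeg m)).+1.
have us : uniq s by apply: finite_support_uniq.
rewrite (perm_big [seq bmnm p | p <- enum {: 'X_{1..N < D}} & bmnm p \in s]); last first.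
  apply: uniq_perm => //.
    rewrite map_inj_uniq; first by rewrite filter_uniq ?enum_uniq.
    by move=> p q e; apply: val_inj.
  move=> m; apply/idP/mapP => [ms|[p]]; last by rewrite mem_filter => /andP[hp _] ->.
  have hm : (mdeg m < D)%N.
    by rewrite ltnS (big_rem m) //= leq_maxl.
  by exists (BMultinom hm) => //; rewrite mem_filter mem_enum ms.
rewrite big_map big_filter big_enum_cond /=.
apply: (@le_trans _ _ (\sum_(p : 'X_{1..N < D}) M * (1 / 2) ^+ mdeg p)).
  rewrite [leRHS](bigID (fun p : 'X_{1..N < D} => bmnm p \in s)) /=.
  apply: ler_wpDr.
    by apply: sumr_ge0 => p _; rewrite mulr_ge0 ?exprn_ge0 ?divr_ge0.
  apply: ler_sum => p _; apply: le_trans (ler_wpM2r _ (h p)) _.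
    by rewrite exprn_ge0 ?ltW.
  rewrite -mulrA -exprMn /r mulrA mulfV ?gt_eqF //.
by rewrite -mulr_sumr ler_wpM2l // sum_geometric //.
Qed.

End Summability.

(** * Majorants *)

Section Weights.
Variables (R : realType) (N : nat) (c : 'I_N -> R).
Hypothesis c_gt0 : forall i, 0 < c i.
Implicit Types (m : 'X_{1..N}).
Local Notation L := (\sum_i c i *: 'X_i : {mpoly R[N]}).

(** Coefficient of x^m in xi^|m|, for the linear form xi = c_1 x_1 + ... + c_N x_N: a multinomial
    coefficient times c^m. Reading it off a power of xi replaces factorial identities by xi^p xi^q =
    xi^(p+q) and the derivative of xi^(p+1). *)
Definition lam m : R := (L ^+ mdeg m)@_m.

Lemma Lpow_ge0 p m : 0 <= (L ^+ p)@_m.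
Proof.
elim: p m => [|p IH] m; first by rewrite expr0 mcoeff1 ler0n.
rewrite exprS mcoeffM; apply: sumr_ge0 => k _; apply: mulr_ge0 => //.
rewrite raddf_sum /=; apply: sumr_ge0 => i _.
by rewrite mcoeffZ mcoeffX mulr_ge0 ?ler0n // ltW.
Qed.

Lemma lam_ge0 m : 0 <= lam m. Proof. exact: Lpow_ge0. Qed.

Lemma lam0 : lam 0%MM = 1.
Proof. by rewrite /lam mdeg0 expr0 mcoeff1 eqxx. Qed.

Lemma L_homog p : L ^+ p \is p.-homog.
Proof.
have L1 : L \is 1.-homog.
  by apply: rpred_sum => i _; apply: rpredZ; rewrite dhomogX /= mdeg1.
elim: p => [|p IH]; first by rewrite expr0 dhomog1.
by rewrite exprS -add1n; apply: dhomogM.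
Qed.

(** xi^|m| = xi^p xi^(|m| - p), and by homogeneity only the pairs whose first member has degree p
    contribute. *)
Lemma lam_conv m p : (p <= mdeg m)%N ->
  \sum_(k : 'X_{1..N < (mdeg m).+1, (mdeg m).+1} |
      (m == (k.1 + k.2)%MM) && (mdeg k.1 == p)) lam k.1 * lam k.2 = lam m.
Proof.
move=> hp; rewrite /lam -[in RHS](subnKC hp) exprD mcoeffM.
rewrite [RHS](bigID (fun k : 'X_{1..N < (mdeg m).+1, (mdeg m).+1} =>
  mdeg k.1 == p)) /= [X in _ = _ + X]big1 ?addr0.
  apply: eq_bigr => k /andP[/eqP km /eqP kp]; rewrite kp.
  suff -> : mdeg k.2 = (mdeg m - p)%N by [].
  have := congr1 (@mdeg _) km; rewrite /= mdegD kp => e.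
  by rewrite [X in (X - _)%N]e addKn.
move=> k /andP[_ hk].
by rewrite (dhomog_nemf_coeff (L_homog p)) ?mul0r.
Qed.

Lemma mderiv_L i : mderiv i L = (c i)%:MP.
Proof.
have U0 : (U_(i) - U_(i))%MM = 0%MM :> 'X_{1..N}.
  by apply/mnmP => j; rewrite mnmBE subnn mnm0E.
rewrite raddf_sum /= (bigD1 i) //= mderivZ mderivX mnm1E eqxx U0 mpolyX0.
rewrite big1 ?addr0 => [|j hj]; first by rewrite scale1r -mul_mpolyC mulr1.
by rewrite mderivZ mderivX mnm1E (negbTE hj) scale0r scaler0.
Qed.

Lemma mderiv_Lpow i p : mderiv i (L ^+ p.+1) = (p.+1%:R * c i) *: L ^+ p.
Proof.
elim: p => [|p IH]; first by rewrite expr1 expr0 mderiv_L mul1r -mul_mpolyC mulr1.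
rewrite exprS mderivM IH mderiv_L mul_mpolyC -scalerAr -exprS -scalerDl.
by congr (_ *: _); rewrite [in RHS]mulrS mulrDl mul1r.
Qed.

(** Compare coefficients in d xi^(|m|+1) / dx_i = (|m| + 1) c_i xi^|m|. *)
Lemma lam_shift m i :
  (m i).+1%:R * lam (m + U_(i))%MM = (mdeg m).+1%:R * c i * lam m.
Proof.
by rewrite /lam mdegD mdeg1 addn1 mulr_natl -mcoeff_deriv mderiv_Lpow mcoeffZ.
Qed.

Lemma lamU i : lam U_(i)%MM = c i.
Proof.
by have := lam_shift 0%MM i; rewrite mnm0E mdeg0 lam0 add0m !mul1r mulr1.
Qed.

(** Evaluate xi^|m| at (1, ..., 1): all its coefficients are nonnegative, so each is at most their
    sum. *)
Lemma lam_le m : lam m <= (\sum_i c i) ^+ mdeg m.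
Proof.
rewrite /lam; move: (mdeg m) => p.
have -> : \sum_i c i = L.@[fun=> 1].
  rewrite raddf_sum /=; apply: eq_bigr => i _.
  by rewrite mevalZ mevalXU mulr1.
rewrite -rmorphXn /= mevalE.
case: (boolP (m \in msupp (L ^+ p))) => [hm|]; last first.
  rewrite -mcoeff_eq0 => /eqP ->; apply: sumr_ge0 => k _.
  by rewrite mulr_ge0 ?Lpow_ge0 // prodr_ge0 // => i _; rewrite expr1n.
rewrite (big_rem m) //= [X in _ * X]big1 ?mulr1 => [|i _]; last by rewrite expr1n.
rewrite lerDl; apply: sumr_ge0 => k _.
by rewrite mulr_ge0 ?Lpow_ge0 // prodr_ge0 // => i _; rewrite expr1n.
Qed.

Lemma sum_inv_square p :
  \sum_(i < p.+1) (i.+1%:R ^- 2 : R) <= 2 - (p.+1%:R)^-1.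
Proof.
elim: p => [|p IH].
  by rewrite big_ord1 expr1n invr1 -[2]/(1 + 1) addrK.
rewrite big_ord_recr /=; apply: le_trans (lerD IH (lexx _)) _.
rewrite -[p.+2%:R]natr1; set x : R := p.+1%:R.
have x0 : 0 < x by rewrite ltr0n.
rewrite -addrA lerD2l -subr_ge0.
have -> : - (x + 1)^-1 - (- x^-1 + (x + 1) ^- 2) = (x * (x + 1) ^+ 2)^-1.
  by field; rewrite !gt_eqF // addr_gt0.
by rewrite invr_ge0 mulr_ge0 ?exprn_ge0 ?ltW // addr_gt0.
Qed.

(** With x = i + 1 and y = p - i + 1 one has p + 1 = x + y - 1 and (x + y - 1)^2 <= 2 (x^2 + y^2),
    so each term is at most 2 (p + 1)^-2 (x^-2 + y^-2). Each of the two resulting sums is at most 2,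
    whence 8 = 2 (2 + 2). *)
Lemma conv_inv_square p :
  \sum_(i < p.+1) (i.+1%:R ^- 2 * (p - i).+1%:R ^- 2 : R) <= 8 * p.+1%:R ^- 2.
Proof.
apply: (@le_trans _ _ (\sum_(i < p.+1)
   2 * p.+1%:R ^- 2 * (i.+1%:R ^- 2 + (p - i).+1%:R ^- 2 : R))).
  apply: ler_sum => i _; set x : R := i.+1%:R; set y : R := (p - i).+1%:R.
  have e : p.+1%:R = x + y - 1 :> R.
    rewrite /x /y -natrD -[1]/(1%:R) -natrB; last by rewrite addSn.
    by congr (_%:R); have := ltn_ord i; lia.
  have x1 : 1 <= x by rewrite ler1n.
  have y1 : 1 <= y by rewrite ler1n.
  rewrite e -subr_ge0.
  have z0 : 0 < x + y - 1 by lra.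
  have -> : 2 * (x + y - 1) ^- 2 * (x ^- 2 + y ^- 2) - x ^- 2 * y ^- 2 =
    (2 * (x ^+ 2 + y ^+ 2) - (x + y - 1) ^+ 2) / (x * y * (x + y - 1)) ^+ 2.
    by field; rewrite !gt_eqF //; lra.
  apply: divr_ge0; last by rewrite exprn_ge0 // !mulr_ge0; lra.
  have -> : 2 * (x ^+ 2 + y ^+ 2) - (x + y - 1) ^+ 2 =
    (x - y) ^+ 2 + (2 * (x + y) - 1) by ring.
  by rewrite addr_ge0 ?sqr_ge0 //; lra.
rewrite -mulr_sumr big_split /=.
rewrite [X in _ + X](reindex_inj rev_ord_inj) /=.
have -> : \sum_(j < p.+1) ((p - (p.+1 - j.+1)).+1%:R ^- 2 : R) =
          \sum_(i < p.+1) (i.+1%:R ^- 2 : R).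
  by apply: eq_bigr => j _; rewrite subSS subKn // -ltnS.
have := sum_inv_square p.
set s := \sum_(_ < _) _; have : 0 <= (p.+1%:R)^-1 :> R by rewrite invr_ge0 ler0n.
have : 0 <= p.+1%:R ^- 2 :> R by rewrite invr_ge0 exprn_ge0 ?ler0n.
by set a := p.+1%:R ^- 2; set b := _^-1 => a0 b0 h; nra.
Qed.

Implicit Types (a b y : mfps R N).
Local Notation nc := Normc.normc.

(* The factor 8 makes these balls multiplicative for q = 2, see [bndM]. *)
Definition bnd (q : nat) (th : R) a : Prop := forall m,
  nc (a m) <= th / 8 * (mdeg m).+1%:R ^- q * lam m.

Lemma wq_ge0 q k : 0 <= (k%:R : R) ^- q.
Proof. by rewrite invr_ge0 exprn_ge0 ?ler0n. Qed.

Lemma bnd_ge0 q th a : bnd q th a -> 0 <= th.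
Proof.
move=> /(_ 0%MM); rewrite lam0 mdeg0 expr1n invr1 !mulr1 => h.
have := le_trans (nc_ge0 _) h; lra.
Qed.

Lemma bnd_le q th th' a : th <= th' -> bnd q th a -> bnd q th' a.
Proof.
move=> h ha m; apply: le_trans (ha m) _.
by rewrite ler_wpM2r ?lam_ge0 // ler_wpM2r ?wq_ge0 // ler_pM2r ?invr_gt0 ?ltr0n.
Qed.

Lemma bndD q th th' a b : bnd q th a -> bnd q th' b -> bnd q (th + th') (a + b).
Proof.
move=> ha hb m; rewrite psD; apply: le_trans (ncD _ _) _.
by apply: le_trans (lerD (ha m) (hb m)) _; rewrite !mulrDl.
Qed.

Lemma bndN q th a : bnd q th a -> bnd q th (- a).
Proof. by move=> ha m; rewrite psN ncN. Qed.

Lemma bnd0 q : bnd q 0 0.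
Proof. by move=> m; rewrite ps0 nc0 !mul0r. Qed.

Lemma bnd1 q : bnd q 8 1.
Proof.
move=> m; rewrite ps1 divff ?pnatr_eq0 // mul1r.
case: eqP => [->|_]; last by rewrite nc0 mulr_ge0 ?wq_ge0 ?lam_ge0.
by rewrite nc1 mdeg0 expr1n invr1 lam0 mulr1.
Qed.

(** 32 = 8 * 2^2, the decay factor in degree 1 being 2^-2. Large weights make the coordinates
    small. *)
Lemma bndX i : bnd 2 (32 / c i) (ps_X i).
Proof.
move=> m; rewrite psXE; case: eqP => [->|_]; last first.
  by rewrite nc0 !mulr_ge0 ?wq_ge0 ?lam_ge0 ?invr_ge0 ?ler0n // ltW.
rewrite nc1 mdeg1 lamU.
have -> : 32 / c i / 8 * 2 ^- 2 * c i = 1; last by [].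
by field; rewrite gt_eqF.
Qed.

(** The pairs of monomials are grouped by the degree of the first: [lam_conv] sums each group and
    [conv_inv_square] sums over the groups. *)
Lemma bndM th th' a b : bnd 2 th a -> bnd 2 th' b -> bnd 2 (th * th') (a * b).
Proof.
move=> ha hb m; have [t0 t0'] := (bnd_ge0 ha, bnd_ge0 hb).
rewrite -ps_mulE /ps_mul; apply: le_trans (nc_sum _ _ _) _.
rewrite (partition_big (fun k : 'X_{1..N < (mdeg m).+1, (mdeg m).+1} =>
  inord (mdeg k.1) : 'I_(mdeg m).+1) predT) //=.
apply: (@le_trans _ _ (\sum_(j < (mdeg m).+1) th / 8 * (th' / 8) *
   (j.+1%:R ^- 2 * (mdeg m - j).+1%:R ^- 2) * lam m)).
  apply: ler_sum => j _.
  have jm : (j <= mdeg m)%N by rewrite -ltnS.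
  rewrite -(lam_conv jm) mulr_sumr.
  rewrite (eq_bigl (fun k : 'X_{1..N < (mdeg m).+1, (mdeg m).+1} =>
     (m == (k.1 + k.2)%MM) && (mdeg k.1 == j))); last first.
    move=> k /=; congr (_ && _); apply/eqP/eqP => [<-|h].
      by rewrite inordK // bmdeg.
    by apply: val_inj; rewrite /= inordK // bmdeg.
  apply: ler_sum => k /andP[/eqP km /eqP kj].
  have k2 : mdeg k.2 = (mdeg m - j)%N.
    have := congr1 (@mdeg _) km; rewrite /= mdegD kj => e.
    by rewrite [X in (X - _)%N]e addKn.
  rewrite Normc.normcM.
  apply: le_trans (ler_pM (nc_ge0 _) (nc_ge0 _) (ha _) (hb _)) _.
  by rewrite kj k2 le_eqVlt; apply/orP; left; apply/eqP; ring.
rewrite -mulr_suml ler_wpM2r ?lam_ge0 // -mulr_sumr.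
apply: le_trans (ler_wpM2l _ (conv_inv_square (mdeg m))) _.
  by rewrite mulr_ge0 ?divr_ge0.
rewrite le_eqVlt; apply/orP; left; apply/eqP.
by move: ((mdeg m).+1%:R ^- 2) => u; field.
Qed.

Lemma bnd_dg q th k a : (forall m, nc (k m) <= 1) -> bnd q th a ->
  bnd q th (dg k a).
Proof.
move=> hk ha m; rewrite /dg Normc.normcM; apply: le_trans (ha m).
by rewrite ler_piMl ?nc_ge0.
Qed.

(** A multiplier of linear growth costs one power of decay; this is the derivative loss, from q = 3
    to q = 2, of the evolution equation. *)
Lemma bnd_dgS q th K k a :
  0 <= K -> (forall m, nc (k m) <= K * (mdeg m).+1%:R) -> bnd q.+1 th a ->
  bnd q (K * th) (dg k a).
Proof.
move=> K0 hk ha m; rewrite /dg Normc.normcM.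
apply: le_trans (ler_pM (nc_ge0 _) (nc_ge0 _) (hk m) (ha m)) _.
rewrite exprS; set x : R := (mdeg m).+1%:R.
have x0 : x != 0 by rewrite pnatr_eq0.
have y0 : x ^+ q != 0 by rewrite expf_neq0.
rewrite le_eqVlt; apply/orP; left; apply/eqP.
move: (x ^+ q) y0 => y y0; move: x x0 => x x0.
by field; rewrite x0 y0.
Qed.

Lemma bndS q th a : bnd q.+1 th a -> bnd q th a.
Proof.
move=> h; have -> : a = dg (fun=> 1) a.
  by apply: mfpsP => m; rewrite /dg mul1r.
rewrite -[th]mul1r; apply: bnd_dgS h; first exact: ler01.
by move=> m; rewrite nc1 mul1r ler1n.
Qed.

Lemma bnd_sum q I (r : seq I) (P : pred I) (th : I -> R) (F : I -> mfps R N) :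
  (forall i, P i -> bnd q (th i) (F i)) ->
  bnd q (\sum_(i <- r | P i) th i) (\sum_(i <- r | P i) F i).
Proof.
move=> h; apply: (big_ind2 (fun t a => bnd q t a)) => //; first exact: bnd0.
by move=> *; apply: bndD.
Qed.

Lemma bnd_convergent q th a : bnd q th a -> ps_convergent a.
Proof.
move=> h; have t0 := bnd_ge0 h.
have s0 : 0 <= \sum_i c i by apply: sumr_ge0 => i _; rewrite ltW.
apply: (@geometric_convergent _ _ _ (th / 8) (\sum_i c i + 1)).
  by rewrite ltr_wpDl.
move=> m; apply: le_trans (h m) _; rewrite -mulrA ler_wpM2l ?divr_ge0 //.
apply: (@le_trans _ _ (lam m)).
  rewrite ler_piMl ?lam_ge0 // invf_le1 ?exprn_gt0 ?ltr0n //.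
  by rewrite exprn_ege1 // ler1n.
apply: le_trans (lam_le m) _; rewrite lerXn2r ?nnegrE ?addr_ge0 //.
by rewrite lerDl.
Qed.

(** The ball of radius 16 is stable under j |-> y (1 + j), since eta (8 + 16) <= 12. *)
Lemma bnd_geom eta y j : y 0%MM = 0 -> bnd 2 eta y -> eta <= 1 / 2 ->
  y * (1 + j) = j -> j 0%MM = 0 -> bnd 2 16 j.
Proof.
move=> y0 hy he ej j0.
have [j' [j'0 ej' hQ]] := contracting_fixpoint (contracting_geom y0).
have -> : j = j' by apply: contracting_unique (contracting_geom y0) _ _ ej ej'.
apply: (hQ (fun m x => nc x <= 16 / 8 * (mdeg m).+1%:R ^- 2 * lam m)).
  by move=> m; rewrite nc0 !mulr_ge0 ?wq_ge0 ?lam_ge0.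
move=> b _ hb; have := bndM hy (bndD (bnd1 2) hb); apply: bnd_le.
by have := bnd_ge0 hy; lra.
Qed.

Lemma bnd_inv eta y : y 0%MM = 0 -> bnd 2 eta y -> eta <= 1 / 2 ->
  bnd 2 24 (psinv (1 - y)).
Proof.
move=> y0 hy he.
have [j [j0 ej _]] := contracting_fixpoint (contracting_geom y0).
rewrite (psinv_geomE y0 ej); apply: bnd_le (bndD (bnd1 2) (bnd_geom y0 hy he ej j0)).
by lra.
Qed.

Lemma bndXn_sub1 th s k : th <= 1 -> bnd 2 th s ->
  bnd 2 (2 ^+ k * th) ((1 + s) ^+ k - 1).
Proof.
move=> t1 hs; have t0 := bnd_ge0 hs.
(* The sharper 2^k - 1 survives the induction: th <= 1 lets the product term s ((1 + s)^k - 1) be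
   absorbed. *)
suff: bnd 2 ((2 ^+ k - 1) * th) ((1 + s) ^+ k - 1).
  by apply: bnd_le; rewrite ler_wpM2r // lerBlDr lerDl.
elim: k => [|k IH]; first by rewrite !expr0 !subrr mul0r; exact: bnd0.
have -> : (1 + s) ^+ k.+1 - 1 =
    ((1 + s) ^+ k - 1) + s + s * ((1 + s) ^+ k - 1) by rewrite exprS; ring.
apply: bnd_le (bndD (bndD IH hs) (bndM hs IH)).
rewrite exprS; have u1 : 1 <= (2 : R) ^+ k by rewrite exprn_ege1 ?ler1n.
move: (2 ^+ k) u1 => u u1.
have : 0 <= (u - 1) * th * (1 - th) by rewrite !mulr_ge0 // subr_ge0.
by nra.
Qed.

End Weights.

(** * Majorants under composition *)

Section CompBound.
Variables (R : realType) (N M : nat) (c : 'I_M -> R).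
Hypothesis c_gt0 : forall i, 0 < c i.
Implicit Types (f : mfps R N) (Phi : 'I_N -> mfps R M).
Local Notation nc := Normc.normc.

Lemma bnd_monomial th Phi (p : 'X_{1..N}) : (forall i, bnd c 2 th (Phi i)) ->
  bnd c 2 (8 * th ^+ mdeg p) (\prod_i Phi i ^+ p i).
Proof.
(* [T] bounds multiplication by a as an operator. Since 1 has norm 8, multiplying the norms of the N
   powers would cost a factor 8 for each zero exponent; here 8 enters once. *)
move=> h; pose T (d : nat) (a : mfps R M) :=
  forall y eta, bnd c 2 eta y -> bnd c 2 (th ^+ d * eta) (a * y).
have T0 : T 0%N 1 by move=> y eta hy; rewrite expr0 !mul1r.
have TM d d' a a' : T d a -> T d' a' -> T (d + d')%N (a * a').
  by move=> ha ha' y eta hy; rewrite exprD -!mulrA; apply: ha; apply: ha'.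
have T1 i : T 1%N (Phi i) by move=> y eta hy; rewrite expr1; apply: bndM.
have TX i e : T e (Phi i ^+ e).
  elim: e => [|e IH]; first by rewrite expr0.
  by rewrite exprS -add1n; apply: TM.
have TP : T (\sum_i p i)%N (\prod_i Phi i ^+ p i).
  by apply: (big_ind2 T) => //; move=> *; apply: TM.
by have := TP _ _ (bnd1 c_gt0 2); rewrite -mdegE mulr1 mulrC.
Qed.

(** For |p| >= k and th <= r one has th^|p| <= r^|p| (th/r)^k, so vanishing of f to order k makes
    the composite small with th. *)
Lemma bnd_comp_gen f r K th Phi k :
  0 < r -> sum_le f r K -> (forall i, bnd c 2 th (Phi i)) -> 0 <= th -> th <= r ->
  (forall p : 'X_{1..N}, (mdeg p < k)%N -> f p = 0) -> 
  bnd c 2 (8 * (th / r) ^+ k * K) (ps_comp f Phi).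
Proof.
move=> r0 hf hP t0 tr hk m; rewrite ps_compE; apply: le_trans (nc_sum _ _ _) _.
pose B := (mdeg m).+1%:R ^- 2 * lam c m.
have B0 : 0 <= B by rewrite mulr_ge0 ?wq_ge0 ?lam_ge0.
apply: (@le_trans _ _ (\sum_(p : 'X_{1..N < (mdeg m).+1})
    (nc (f p) * r ^+ mdeg p) * ((th / r) ^+ k * B))).
  apply: ler_sum => p _; rewrite Normc.normcM -mulrA.
  case: (ltnP (mdeg p) k) => hp; first by rewrite hk // nc0 !mul0r.
  rewrite ler_wpM2l ?nc_ge0 //.
  apply: le_trans (bnd_monomial p hP m) _.
  have -> (x : R) : 8 * x / 8 = x by field.
  rewrite -mulrA -/B [leRHS]mulrA.
  rewrite ler_wpM2r //.
  have -> : th ^+ mdeg p = r ^+ mdeg p * (th / r) ^+ mdeg p.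
    by rewrite -exprMn mulrC divfK // gt_eqF.
  rewrite ler_wpM2l ?exprn_ge0 ?(ltW r0) //.
  rewrite -(subnKC hp) exprD ler_piMr ?exprn_ge0 ?divr_ge0 ?(ltW r0) //.
  by rewrite exprn_ile1 ?divr_ge0 ?(ltW r0) // ler_pdivrMr ?mul1r.
rewrite -mulr_suml; apply: le_trans (ler_wpM2r _ (hf _)) _.
  by rewrite mulr_ge0 ?exprn_ge0 ?divr_ge0 ?(ltW r0).
rewrite le_eqVlt; apply/orP; left; apply/eqP; rewrite /B.
set u := _ ^- 2; set v := (th / r) ^+ k; set l := lam c m.
by field.
Qed.

Lemma bnd_comp f r K th Phi :
  0 < r -> sum_le f r K -> (forall i, bnd c 2 th (Phi i)) -> 0 <= th -> th <= r ->
  bnd c 2 (8 * K) (ps_comp f Phi).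
Proof.
move=> r0 hf hP t0 tr.
by have := @bnd_comp_gen f r K th Phi 0 r0 hf hP t0 tr; rewrite expr0 mulr1; apply.
Qed.

Lemma bnd_comp0 f r K th Phi :
  0 < r -> sum_le f r K -> (forall i, bnd c 2 th (Phi i)) -> 0 <= th -> th <= r ->
  f 0%MM = 0 -> bnd c 2 (8 * (th / r) * K) (ps_comp f Phi).
Proof.
move=> r0 hf hP t0 tr f0.
have := @bnd_comp_gen f r K th Phi 1 r0 hf hP t0 tr; rewrite expr1; apply.
by move=> p; rewrite ltnS leqn0 mdeg_eq0 => /eqP ->.
Qed.

End CompBound.

(** * Closure properties of convergent germs *)

Section Convergence.
Variables (R : realType) (N : nat).
Implicit Types (f g a b : mfps R N).
Local Notation nc := Normc.normc.

Lemma sum_le_mono f r r' M M' : 0 <= r' -> r' <= r -> M <= M' ->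
  sum_le f r M -> sum_le f r' M'.
Proof.
move=> r0 rr MM h D; apply: le_trans MM; apply: le_trans (h D).
apply: ler_sum => p _; rewrite ler_wpM2l ?nc_ge0 //.
by rewrite lerXn2r // nnegrE // (le_trans r0).
Qed.

Lemma sum_le_family (I : finType) (F : I -> mfps R N) :
  (forall i, ps_convergent (F i)) ->
  exists r M, [/\ 0 < r, 0 < M & forall i, sum_le (F i) r M].
Proof.
move=> h; have h' i : exists rM : R * R,
    [/\ 0 < rM.1, 0 < rM.2 & sum_le (F i) rM.1 rM.2].
  by have [r [M hrM]] := convergent_sum_le (h i); exists (r, M).
pose u i := sval (cid (h' i)).
have hu i : [/\ 0 < (u i).1, 0 < (u i).2 & sum_le (F i) (u i).1 (u i).2].
  exact: svalP (cid (h' i)).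
have V0 : 0 <= \sum_i (u i).1^-1.
  by apply: sumr_ge0 => i _; rewrite invr_ge0 ltW //; case: (hu i).
have W0 : 0 <= \sum_i (u i).2 by apply: sumr_ge0 => i _; rewrite ltW //; case: (hu i).
(* A common radius below all the given ones, without a minimum over a possibly empty family. *)
exists (1 + \sum_i (u i).1^-1)^-1, (1 + \sum_i (u i).2); split.
- by rewrite invr_gt0 ltr_wpDr.
- by rewrite ltr_wpDr.
move=> i; have [r0 M0] := hu i; apply: sum_le_mono.
- by rewrite invr_ge0 addr_ge0.
- rewrite -[leRHS]invrK lef_pV2 ?posrE ?invr_gt0 ?ltr_wpDr //.
  rewrite (bigD1 i) //= addrCA lerDl addr_ge0 //.
  by apply: sumr_ge0 => j _; rewrite invr_ge0 ltW //; case: (hu j).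
- rewrite (bigD1 i) //= addrCA lerDl addr_ge0 //.
  by apply: sumr_ge0 => j _; rewrite ltW //; case: (hu j).
Qed.

Lemma convergent_geometric f : ps_convergent f ->
  exists M K, [/\ 0 < M, 1 <= K & forall m, nc (f m) <= M * K ^+ mdeg m].
Proof.
move=> /convergent_sum_le [r [M [r0 M0 h]]]; exists M, (1 + r^-1); split=> //.
  by rewrite lerDl invr_ge0 ltW.
move=> m; apply: (@le_trans _ _ (M * r^-1 ^+ mdeg m)); last first.
  by rewrite ler_pM2l // lerXn2r ?nnegrE ?addr_ge0 ?invr_ge0 ?(ltW r0) // lerDr.
rewrite exprVn ler_pdivlMr ?exprn_gt0 //; apply: le_trans (h (mdeg m).+1).
rewrite (bigD1 (BMultinom (ltnSn (mdeg m)))) //= lerDl.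
by apply: sumr_ge0 => p _; rewrite mulr_ge0 ?nc_ge0 ?exprn_ge0 // ltW.
Qed.

(** Covers division by a monomial, selection of monomials and [gamma]: a relabelling of exponents of
    linear growth preserves geometric bounds. *)
Lemma convergent_shift f g (u v : nat) (sh : 'X_{1..N} -> 'X_{1..N}) :
  ps_convergent f -> (forall m, (mdeg (sh m) <= u * mdeg m + v)%N) ->
  (forall m, nc (g m) <= nc (f (sh m))) -> ps_convergent g.
Proof.
move=> /convergent_geometric [M [K [M0 K1 hf]]] hsh hg.
apply: (@geometric_convergent _ _ _ (M * K ^+ v) (K ^+ u)).
  by rewrite exprn_gt0 // (lt_le_trans ltr01).
move=> m; apply: le_trans (hg m) _; apply: le_trans (hf _) _.
rewrite -mulrA ler_pM2l // -exprM -exprD addnC.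
exact: ler_weXn2l.
Qed.

(** The composition bound applied to f composed with the identity: weights at least 32/r put the
    coordinates in the ball of radius r. *)
Lemma convergent_bnd f : ps_convergent f ->
  exists r0 th, 0 < r0 /\ forall c : 'I_N -> R, (forall i, r0 <= c i) ->
    bnd c 2 th f.
Proof.
move=> /convergent_sum_le [r [M [r0 M0 h]]]; exists (32 / r), (8 * M); split.
  by rewrite divr_gt0.
move=> c hc; have c0 i : 0 < c i by apply: lt_le_trans (hc i); rewrite divr_gt0.
rewrite -[f]pscomp_id.
apply: (@bnd_comp _ _ _ _ c0 _ r _ r) => //; last exact: ltW.
move=> i; apply: bnd_le (bndX c0 i) => //.
by rewrite ler_pdivrMr // mulrC -ler_pdivrMr.
Qed.

Lemma convergent_bnd_small f eta : ps_convergent f -> f 0%MM = 0 -> 0 < eta ->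
  exists r0, 0 < r0 /\ forall c : 'I_N -> R, (forall i, r0 <= c i) ->
    bnd c 2 eta f.
Proof.
move=> /convergent_sum_le [r [M [r0 M0 h]]] f0 e0.
(* Then 8 (th/r) M = 8 M eta / (eta + 8 M), which is at most eta. *)
pose th := r / (1 + 8 * M / eta).
have t1 : 1 <= 1 + 8 * M / eta by rewrite lerDl divr_ge0 ?mulr_ge0 ?ltW.
have t0 : 0 < th by rewrite divr_gt0 // (lt_le_trans ltr01).
exists (32 / th); split; first by rewrite divr_gt0.
move=> c hc; have c0 i : 0 < c i by apply: lt_le_trans (hc i); rewrite divr_gt0.
rewrite -[f]pscomp_id.
apply: (@bnd_le _ _ _ c0 _ (8 * (th / r) * M)); last first.
  apply: bnd_comp0 => //; [|exact: ltW|].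
    move=> i; apply: bnd_le (bndX c0 i) => //.
    by rewrite ler_pdivrMr // mulrC -ler_pdivrMr.
  by rewrite /th ler_pdivrMr ?(lt_le_trans ltr01) // ler_peMr // ltW.
rewrite /th; have -> : r / (1 + 8 * M / eta) / r = eta / (eta + 8 * M).
  by field; rewrite !gt_eqF // addr_gt0 // mulr_gt0.
rewrite mulrAC mulrA ler_pdivrMr ?addr_gt0 ?mulr_gt0 //.
by have := mulr_gt0 e0 e0; lra.
Qed.

Lemma convergentM f g : ps_convergent f -> ps_convergent g ->
  ps_convergent (f * g).
Proof.
move=> /convergent_bnd [r [t [r0 h]]] /convergent_bnd [r' [t' [r0' h']]].
have c0 (i : 'I_N) : 0 < r + r' by rewrite addr_gt0.
apply: (bnd_convergent c0 (q := 2)); apply: bndM => //.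
- by apply: h => i; rewrite lerDl ltW.
- by apply: h' => i; rewrite lerDr ltW.
Qed.

Lemma convergentD f g : ps_convergent f -> ps_convergent g ->
  ps_convergent (f + g).
Proof.
move=> /convergent_bnd [r [t [r0 h]]] /convergent_bnd [r' [t' [r0' h']]].
have c0 (i : 'I_N) : 0 < r + r' by rewrite addr_gt0.
apply: (bnd_convergent c0 (q := 2)); apply: bndD => //.
- by apply: h => i; rewrite lerDl ltW.
- by apply: h' => i; rewrite lerDr ltW.
Qed.

Lemma convergent0 : ps_convergent (0 : mfps R N).
Proof.
apply: (@geometric_convergent _ _ _ 0 1) => // m.
by rewrite ps0 nc0 mul0r.
Qed.

Lemma convergent_cst z : ps_convergent (cst z : mfps R N).
Proof.
apply: (@geometric_convergent _ _ _ (nc z) 1) => // m.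
by rewrite expr1n mulr1 /cst; case: eqP => // _; rewrite nc0 nc_ge0.
Qed.

Lemma convergent_psX i : ps_convergent (ps_X i : mfps R N).
Proof.
apply: (@geometric_convergent _ _ _ 1 1) => // m.
by rewrite expr1n mulr1 psXE nc_nat lern1 leq_b1.
Qed.

Lemma convergentXn f e : ps_convergent f -> ps_convergent (f ^+ e).
Proof.
move=> h; elim: e => [|e IH]; first by rewrite expr0 -cst1; apply: convergent_cst.
by rewrite exprS; apply: convergentM.
Qed.

Lemma convergent_inv f : ps_convergent f -> f 0%MM != 0 ->
  ps_convergent (psinv f).
Proof.
move=> hf f0; pose y := 1 + cst (- (f 0%MM)^-1) * f.
have y0 : y 0%MM = 0 by rewrite /y psD ps1 eqxx cstM_coef mulNr mulVf // subrr.
have cy : ps_convergent y.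
  apply: convergentD; first by rewrite -cst1; apply: convergent_cst.
  by apply: convergentM => //; apply: convergent_cst.
have -> : psinv f = cst (f 0%MM)^-1 * psinv (1 - y).
  have h1 : (1 - y) 0%MM != 0 by rewrite psB y0 ps1 eqxx subr0 oner_neq0.
  apply: psinv_uniq; rewrite mulrA [f * _]mulrC.
  have -> : cst (f 0%MM)^-1 * f = 1 - y by rewrite /y cstN; ring.
  exact: psinvP.
apply: convergentM; first exact: convergent_cst.
have e0 : 0 < 1 / 2 :> R by rewrite divr_gt0.
have [r [r0 h]] := convergent_bnd_small cy y0 e0.
have c0 (i : 'I_N) : 0 < r by [].
apply: (bnd_convergent c0 (q := 2)).
by apply: bnd_inv (h (fun=> r) (fun=> lexx _)) _ => //.
Qed.

Lemma convergent_deriv i f : ps_convergent f -> ps_convergent (ps_deriv i f).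
Proof.
move=> /convergent_bnd [r [t [r0 h]]].
have c0 (j : 'I_N) : 0 < r by [].
have hb := h (fun=> r) (fun=> lexx _); have t0 := bnd_ge0 hb.
apply: (bnd_convergent c0 (q := 1) (th := t * r)) => m.
rewrite /ps_deriv -[X in nc X]mulr_natl Normc.normcM nc_nat.
apply: le_trans (ler_wpM2l _ (hb _)) _; first by rewrite ler0n.
rewrite mdegD mdeg1 addn1 mulrCA lam_shift //.
set x : R := (mdeg m).+1%:R.
have x0 : 0 < x by rewrite ltr0n.
rewrite [(mdeg m).+2%:R](_ : _ = x + 1); last by rewrite /x natr1.
rewrite expr1 !mulrA ler_wpM2r ?lam_ge0 //.
rewrite [t / 8 * _ * _ * _](_ : _ = (t * r / 8) * (x / (x + 1) ^+ 2)); last first.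
  by field; rewrite gt_eqF // addr_gt0.
rewrite ler_wpM2l ?divr_ge0 ?mulr_ge0 ?(ltW r0) //.
rewrite ler_pdivrMr ?exprn_gt0 ?addr_gt0 // ler_pdivlMl //.
move: x x0 {h hb} => x x0; rewrite -expr2 -subr_ge0.
have -> : (x + 1) ^+ 2 - x ^+ 2 = 2 * x + 1 by ring.
by rewrite addr_ge0 // mulr_ge0 // ltW.
Qed.

End Convergence.

Lemma convergent_comp (R : realType) (N M : nat) (f : mfps R N)
    (Phi : 'I_N -> mfps R M) :
  ps_convergent f -> (forall i, ps_convergent (Phi i)) -> nilp_map Phi ->
  ps_convergent (ps_comp f Phi).
Proof.
move=> /convergent_sum_le [r [K [r0 K0 hf]]] hP P0.
pose h i := convergent_bnd_small (hP i) (P0 i) r0.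
pose u i := sval (cid (h i)).
have hu i : 0 < u i /\ forall c : 'I_M -> R, (forall j, u i <= c j) ->
    bnd c 2 r (Phi i) by exact: svalP (cid (h i)).
have U0 : 0 <= \sum_i u i by apply: sumr_ge0 => i _; rewrite ltW //; case: (hu i).
pose c (j : 'I_M) := 1 + \sum_i u i.
have c0 j : 0 < c j by rewrite /c ltr_wpDr.
apply: (bnd_convergent c0 (q := 2)).
apply: (bnd_comp c0 r0 hf (th := r)) => //; last exact: ltW.
move=> i; apply: (hu i).2 => j.
rewrite /c (bigD1 i) //= addrCA lerDl addr_ge0 //.
by apply: sumr_ge0 => k _; rewrite ltW //; case: (hu k).
Qed.

Lemma sum_le_sub0 (R : realType) (N : nat) (f : mfps R N) (r M : R) :
  0 <= r -> sum_le f r M -> sum_le (f - cst (f 0%MM)) r M.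
Proof.
move=> r0 h D; apply: le_trans (h D); apply: ler_sum => p _.
rewrite ler_wpM2r ?exprn_ge0 // psB /cst.
by case: eqP => [->|_]; rewrite ?subrr ?nc0 ?nc_ge0 // subr0.
Qed.

Lemma bnd_cst (R : realType) (N : nat) (c : 'I_N -> R) q th (z : R[i])
    (a : mfps R N) : bnd c q th a -> bnd c q (Normc.normc z * th) (cst z * a).
Proof.
move=> h m; rewrite cstM_coef Normc.normcM -!mulrA ler_wpM2l ?nc_ge0 //.
by rewrite !mulrA.
Qed.

(** * Splitting off the part of g free of z *)

Section Preparation.
Variables (R : realType) (n k : nat).
Local Notation w := (ord_max : 'I_n.+1).
Local Notation nc := Normc.normc.
Implicit Types (a b f g s : mfps R n.+1) (m p : 'X_{1..n.+1}).

Definition z_multiple a : Prop := forall m, zdeg m = 0%N -> a m = 0.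

Lemma z_multipleX i a : i != w -> z_multiple (ps_X i * a).
Proof.
move=> hi m hm; apply: psXM_0.
by move/eqP: hm; rewrite sum_nat_eq0 => /forallP /(_ i) /implyP /(_ hi) /eqP.
Qed.

Lemma z_multipleD a b : z_multiple a -> z_multiple b -> z_multiple (a + b).
Proof. by move=> ha hb m hm; rewrite psD ha ?hb ?addr0. Qed.

(** g (0, w) = w^k g0 (w) gives the first term; every other monomial contains some z_i, which is
    factored out. *)
Lemma regular_decomposition g : ps_convergent g -> w_order_at k g ->
  exists g0 (gz : 'I_n.+1 -> mfps R n.+1),
    [/\ ps_convergent g0, forall i, ps_convergent (gz i), g0 0%MM != 0 &
        g = ps_X w ^+ k * g0 + \sum_(i | i != w) ps_X i * gz i].
Proof.
move=> cg [hlt hk].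
pose g0 : mfps R n.+1 := fun m =>
  if zdeg m == 0%N then g (m + w_pow n k)%MM else 0.
(* One z-variable is selected in each monomial, so that no monomial is counted in two of the
   [gz i]. *)
pose pk m := [pick i | (i != w) && (m i != 0%N)].
pose gz i : mfps R n.+1 := fun m =>
  if pk (m + U_(i))%MM == Some i then g (m + U_(i))%MM else 0.
exists g0, gz; split.
- apply: (@convergent_shift _ _ g _ 1 k (fun m => (m + w_pow n k)%MM)) => // m.
    by rewrite mdegD /w_pow mdegMn mdeg1 !mul1n.
  by rewrite /g0; case: eqP => // _; rewrite nc0 nc_ge0.
- move=> i; apply: (@convergent_shift _ _ g _ 1 1 (fun m => (m + U_(i))%MM)) => // m.
    by rewrite mdegD mdeg1 mul1n.
  by rewrite /gz; case: eqP => // _; rewrite nc0 nc_ge0.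
- rewrite /g0 add0m /zdeg big1 ?eqxx => [|i _]; last by rewrite mnm0E.
  exact/eqP.
apply: mfpsP => m; rewrite psD w_coef_monomial ps_sumE.
have S : \sum_(i | i != w) (ps_X i * gz i) m =
    if pk m is Some i then g m else 0.
  rewrite (eq_bigr (fun i => if pk m == Some i then g m else 0)); last first.
    move=> i hi; rewrite psXM; case: (altP (m i =P 0%N)) => hm.
      case: eqP => // e; move: e; rewrite /pk; case: pickP => // j /andP[_ hj] [ij].
      by rewrite ij hm in hj.
    rewrite /gz submK //; apply/mnm_lepP => j.
    by rewrite mnm1E; case: eqP => // <-; rewrite lt0n.
  have : forall i, pk m = Some i -> i != w.
    by rewrite /pk; case: pickP => // j /andP[hj _] i [<-].
  case: (pk m) => [j|] hj; last by rewrite big1.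
  rewrite (bigD1 j) /=; last exact: hj.
  rewrite eqxx big1 ?addr0 // => i /andP[_ ij].
  by case: eqP => // -[e]; rewrite e eqxx in ij.
rewrite S; case E: (pk m) => [i|].
  move: E; rewrite /pk; case: pickP => // j /andP[hj hm] _.
  have hz (q : 'X_{1..n.+1}) : q j = m j -> zdeg q != 0%N.
    by move=> e; rewrite /zdeg (bigD1 j) //= e addn_eq0 negb_and hm.
  case: leqP => h; last by rewrite add0r.
  rewrite /g0 (negbTE (hz _ _)) ?add0r //.
  by rewrite mnmBE /w_pow mulmnE mnm1E eq_sym (negbTE hj) mul0n subn0.
have hm j : j != w -> m j = 0%N.
  move: E; rewrite /pk; case: pickP => // hj _ jw; apply/eqP.
  by have := hj j; rewrite jw /= => /negbFE.
have mw : m = w_pow n (m w).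
  apply/mnmP => j; rewrite /w_pow mulmnE mnm1E.
  by case: eqP => [<-|/eqP]; rewrite ?mul1n // eq_sym => /hm.
rewrite addr0; case: leqP => h; last by rewrite mw hlt.
rewrite /g0 submK; last first.
  apply/mnm_lepP => i; rewrite /w_pow mulmnE mnm1E.
  by case: eqP => [<-|_]; rewrite ?mul1n.
rewrite /zdeg big1 ?eqxx // => i hi.
by rewrite mnmBE hm // sub0n.
Qed.

End Preparation.

(** * The evolution equation *)

Section Evolution.
Variables (R : realType) (n k : nat).
Local Notation w := (ord_max : 'I_n.+1).
Local Notation nc := Normc.normc.
Local Notation C := k.+1.
Local Notation blC := (@bl R n C).
Implicit Types (a b f g s : mfps R n.+1) (m p : 'X_{1..n.+1}).

Lemma inKpM a b : inKp C a -> inKp C b -> inKp C (a * b).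
Proof.
by move=> ha hb; rewrite -(gammaK ha) -(gammaK hb) -betaM; apply: beta_inKp.
Qed.

Lemma inKpD a b : inKp C a -> inKp C b -> inKp C (a + b).
Proof. by move=> ha hb m hm; rewrite psD ha ?hb ?addr0. Qed.

Lemma inKp_dg c a : inKp C a -> inKp C (dg c a).
Proof. by move=> ha m hm; rewrite /dg ha ?mulr0. Qed.

Lemma inKp1 : inKp C (1 : mfps R n.+1).
Proof. by rewrite -(pscomp1 (blC 0)); apply: beta_inKp. Qed.

(** Since 0^-1 = 0 the result vanishes at z = 0: this encodes the initial condition phi (0, y) =
    y. *)
Definition Einv a := dg (fun m => (zdeg m)%:R^-1) a.

Lemma De_Einv a : z_multiple a -> De (Einv a) = a.
Proof.
move=> h; apply: mfpsP => m; rewrite /De /Einv /dg mulrA.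
have [/eqP z0|z0] := boolP (zdeg m == 0%N); first by rewrite h // mulr0.
by rewrite mulfV ?pnatr_eq0 // mul1r.
Qed.

Lemma dg_XM c i a :
  dg c (ps_X i * a) = ps_X i * dg (fun m => c (m + U_(i))%MM) a.
Proof.
apply: mfpsP => m; rewrite /dg !psXM.
case: (altP (m i =P 0%N)) => h; first by rewrite mulr0.
rewrite submK //; apply/mnm_lepP => j.
by rewrite mnm1E; case: eqP => // <-; rewrite lt0n.
Qed.

(* The gain 1/A is where the derivative loss of the evolution equation is
   absorbed: in terms of xi = A z_1 + ... + A z_n + c_w w, the operator
   a |-> Einv (\sum_i z_i a_i) acts on majorants as integration in xi. *)
Lemma bnd_Einv (A cw M : R) (Y : 'I_n.+1 -> mfps R n.+1) :
  let c i := if i == w then cw else A in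
  0 < A -> 0 < cw ->
  (forall i, i != w -> bnd c 2 M (Y i)) -> 0 <= M ->
  bnd c 3 (8 * M / A) (Einv (\sum_(i | i != w) ps_X i * Y i)).
Proof.
move=> c A0 cw0 hY M0 m.
have c0 i : 0 < c i by rewrite /c; case: eqP.
rewrite /Einv /dg Normc.normcM ps_sumE.
case: (posnP (zdeg m)) => [->|d0].
  rewrite invr0 nc0 mul0r !mulr_ge0 ?wq_ge0 ?lam_ge0 ?invr_ge0 ?(ltW A0) //.
set d := zdeg m in d0 *; set x : R := (mdeg m)%:R.
have dm : (0 < mdeg m)%N by rewrite mdeg_zdeg; lia.
have x1 : 1 <= x by rewrite ler1n.
have d1 : 0 < d%:R :> R by rewrite ltr0n.
(* Proportional to m i: summation over i gives [zdeg m], which the factor from [Einv] cancels. *)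
have K i : i != w -> nc ((ps_X i * Y i) m) <=
    (m i)%:R * (M / 8 * x ^- 2 * (lam c m / (x * A))).
  move=> hi; rewrite psXM; case: (altP (m i =P 0%N)) => [->|h].
    by rewrite nc0 mul0r.
  have le : (U_(i) <= m)%MM.
    by apply/mnm_lepP => j; rewrite mnm1E; case: eqP => // <-; rewrite lt0n.
  apply: le_trans (hY i hi _) _.
  have e1 : (mdeg (m - U_(i))).+1 = mdeg m.
    by rewrite -[in RHS](submK le) mdegD mdeg1 addn1.
  have := lam_shift c (m - U_(i))%MM i.
  rewrite submK // e1 mnmBE mnm1E eqxx subn1 prednK ?lt0n // /c (negbTE hi) -/c => e2.
  rewrite -/x in e2; rewrite -/x mulrCA ler_wpM2l ?mulr_ge0 ?divr_ge0 ?wq_ge0 //.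
  rewrite mulrA e2 mulrAC mulfV ?mul1r //.
  by rewrite mulf_neq0 // gt_eqF // (lt_le_trans ltr01).
rewrite Normc.normcV nc_nat mulrC ler_pdivrMr //.
apply: le_trans (nc_sum _ _ _) _; apply: le_trans (ler_sum _ K) _.
rewrite -mulr_suml -natr_sum -[(\sum_(i | _) _)%N]/d mulrC ler_pM2r //.
rewrite -[(mdeg m).+1%:R]natr1 -/x; set l := lam c m.
have l0 : 0 <= l by apply: lam_ge0.
have -> : M / 8 * x ^- 2 * (l / (x * A)) = M * l / (8 * A) * x ^- 3.
  by field; rewrite !gt_eqF // (lt_le_trans ltr01).
have -> : 8 * M / A / 8 * (x + 1) ^- 3 * l =
    M * l / (8 * A) * (8 * (x + 1) ^- 3).
  by field; rewrite !gt_eqF // addr_gt0 // (lt_le_trans ltr01).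
rewrite ler_wpM2l ?divr_ge0 ?mulr_ge0 ?(ltW A0) //.
have x0 : 0 < x by apply: lt_le_trans x1.
rewrite ler_pdivlMr ?exprn_gt0 ?addr_gt0 // mulrC ler_pdivrMr ?exprn_gt0 //.
(* The factor 8 of the statement is 2^3: x + 1 <= 2 x converts x^-3 into (x + 1)^-3. *)
rewrite [leRHS](_ : _ = (2 * x) ^+ 3); last by rewrite exprMn; ring.
by rewrite lerXn2r ?nnegrE ?mulr_ge0 ?addr_ge0 ?(ltW x0) //; lra.
Qed.

(** Weight 64/th gives w the norm th/2, so w + w s has norm at most th when s has norm at most 1.
    The bounds hold for all large A, which leaves A free. *)
Lemma bnd_bl (C0 : nat) (th A : R) s :
  let c i := if i == w then 64 / th else A in
  0 < th -> th <= 1 -> 32 / th <= A -> bnd c 2 1 s ->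
  forall i, bnd c 2 th (bl C0 s i).
Proof.
move=> c t0 t1 hA hs i.
have A0 : 0 < A by apply: lt_le_trans hA; rewrite divr_gt0.
have c0 j : 0 < c j by rewrite /c; case: eqP => // _; rewrite divr_gt0.
have hX : bnd c 2 (th / 2) (ps_X w).
  have -> : th / 2 = 32 / c w by rewrite /c eqxx; field; rewrite gt_eqF.
  exact: bndX.
case: (altP (i =P w)) => [->|hi].
  by rewrite bl_w mulrDr mulr1; apply: bnd_le (bndD hX (bndM c0 hX hs)) => //; lra.
rewrite bl_z //; elim: C0 => [|j IH].
  rewrite expr0 mulr1; apply: bnd_le (bndX c0 i) => //.
  by rewrite /c (negbTE hi) ler_pdivrMr // mulrC -ler_pdivrMr.
rewrite exprSr mulrA; apply: bnd_le (bndM c0 IH hX) => //.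
have : 0 <= th * (1 - th / 2) by rewrite mulr_ge0 ?subr_ge0 ?(ltW t0) //; lra.
by lra.
Qed.

Lemma bnd_Dw (c : 'I_n.+1 -> R) th s : bnd c 3 th s ->
  bnd c 2 (k.+2%:R * th) (Dw C s).
Proof.
apply: bnd_dgS; first by rewrite ler0n.
move=> m; apply: le_trans (ncD _ _) _.
rewrite ncN !nc_nat -natrD -natrM ler_nat mdeg_zdeg.
move: (zdeg m) (fun_of_multinom m w) => u v; nia.
Qed.

Variables (f : 'I_n.+1 -> mfps R n.+1) (g0 : mfps R n.+1)
  (gz : 'I_n.+1 -> mfps R n.+1).
Hypothesis g00 : g0 0%MM != 0.

(* Here [s] is the blown-up U in phi = y (1 + U), and g = w^k g0 +
   \sum_i z_i gz_i. Then [ghat s], [dphi s], [ehat s] and [log_slope s] are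
   g (z, phi) / y^k, phi_y, their product and H (z, phi) / (y phi_y). *)
Definition ghat s := \sum_(i | i != w) ps_X i * (ps_X w * ps_comp (gz i) (blC s)) +
  (1 + s) ^+ k * ps_comp g0 (blC s).
Definition dphi s : mfps R n.+1 := 1 + s + Dw C s.
Definition ehat s := ghat s * dphi s.
Definition log_slope s := \sum_(i | i != w)
  ps_X i * (ps_comp (f i) (blC s) * psinv (ehat s)).
(** For phi = y (1 + U) one has E phi = y E U; dividing the evolution equation by y turns exponents
    at least 1 into exponents at least 0, that is, P_+ into [Pp]. *)
Definition evolution_map s := - Einv (dphi s * Pp C (log_slope s)).

(** Each z_i = z'_i w^(k+1) supplies the factor w^k with z'_i w left over, so the quotient keeps the
    constant term of g0 and is a unit. *)
Lemma ghatE s : ps_X w ^+ k * ghat s =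
  ps_comp (ps_X w ^+ k * g0 + \sum_(i | i != w) ps_X i * gz i) (blC s).
Proof.
have nl := bl_nilp C s.
rewrite pscompD pscompM // pscompXn // pscomp_X // bl_w pscomp_sum addrC /ghat.
rewrite mulrDr mulr_sumr; congr (_ + _); last by rewrite exprMn; ring.
apply: eq_bigr => i hi; rewrite pscompM // pscomp_X // bl_z // exprS; ring.
Qed.

Lemma dphi0 s : s 0%MM = 0 -> dphi s 0%MM = 1.
Proof. by move=> s0; rewrite /dphi !psD /Dw /dg s0 mulr0 ps1 eqxx !addr0. Qed.

Lemma ghat0 s : s 0%MM = 0 -> ghat s 0%MM = g0 0%MM.
Proof.
move=> s0; rewrite /ghat psD ps_sumE big1 => [|i _].
  rewrite add0r psM0 pscomp_coef0; last exact: bl_nilp.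
  suff -> : ((1 + s) ^+ k) 0%MM = 1 by rewrite mul1r.
  elim: k => [|j IH]; first by rewrite expr0 ps1 eqxx.
  by rewrite exprS psM0 IH psD ps1 eqxx s0 addr0 mulr1.
by rewrite psM0 psX0 mul0r.
Qed.

Lemma ehat0 s : s 0%MM = 0 -> ehat s 0%MM = g0 0%MM.
Proof. by move=> s0; rewrite /ehat psM0 ghat0 // dphi0 // mulr1. Qed.

Lemma eqd_ghat d s s' : eqd d s s' -> eqd d (ghat s) (ghat s').
Proof.
move=> h; have hb i : eqd d (blC s i) (blC s' i).
  exact: eqd_le (leqnSn d) (eqd_bl _ _ h).
apply: eqdD; first by apply: eqd_sum => i _; do 2!apply: eqdM => //; apply: eqd_comp.
by apply: eqdM; [apply: eqdX; apply: eqdD|apply: eqd_comp].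
Qed.

Lemma eqd_dphi d s s' : eqd d s s' -> eqd d (dphi s) (dphi s').
Proof. by move=> h; apply: eqdD; [apply: eqdD|apply: eqd_dg]. Qed.

(** The factor z_i is moved out of the projection, whose weight is shifted accordingly. The
    resulting form [Einv] of a sum of z_i Y_i is what the contraction and [bnd_Einv] require. *)
Lemma evolution_mapE s : evolution_map s = - Einv (\sum_(i | i != w) ps_X i * (dphi s *
  dg (fun m => (C * zdeg (m + U_(i)) <= (m + U_(i))%MM w)%N%:R)
     (ps_comp (f i) (blC s) * psinv (ehat s)))).
Proof.
rewrite /evolution_map /Pp /log_slope dg_sum mulr_sumr; congr (- Einv _).
by apply: eq_bigr => i _; rewrite dg_XM mulrCA.
Qed.

Lemma evolution_contracting : contracting evolution_map.
Proof.
split=> [s _|d s s' s0 s0' h].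
  rewrite /evolution_map psN /Einv /dg (_ : zdeg 0%MM = 0%N) ?invr0 ?mul0r ?oppr0 //.
  by rewrite /zdeg big1 // => i _; rewrite mnm0E.
rewrite !evolution_mapE; apply: eqdN; apply: eqd_dg; apply: eqd_sum => i _.
rewrite -[d.+1]addn1; apply: eqdMl; first by apply: eqd1_0; rewrite psX0.
apply: eqdM; first exact: eqd_dphi.
apply: eqd_dg; apply: eqdM.
  by apply: eqd_comp => // j; apply: eqd_le (leqnSn d) (eqd_bl _ _ h).
apply: eqd_inv; rewrite ?ehat0 //.
by apply: eqdM; [apply: eqd_ghat|apply: eqd_dphi].
Qed.

End Evolution.

(** * An invariant ball for the evolution equation *)

Section Existence.
Variables (R : realType) (n k : nat).
Local Notation w := (ord_max : 'I_n.+1).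
Local Notation nc := Normc.normc.
Local Notation C := k.+1.
Local Notation blC := (@bl R n C).
Implicit Types (a b s : mfps R n.+1) (m p : 'X_{1..n.+1}).
Variables (f : 'I_n.+1 -> mfps R n.+1) (g0 : mfps R n.+1)
  (gz : 'I_n.+1 -> mfps R n.+1).
Hypotheses (cf : forall i, ps_convergent (f i)) (cg0 : ps_convergent g0)
  (cgz : forall i, ps_convergent (gz i)) (g00 : g0 0%MM != 0).
Local Notation ghat := (@ghat R n k g0 gz).
Local Notation dphi := (@dphi R n k).
Local Notation ehat := (@ehat R n k g0 gz).
Local Notation log_slope := (@log_slope R n k f g0 gz).
Local Notation evolution_map := (@evolution_map R n k f g0 gz).

Section Bounds.
Variables (r K th A : R).
Hypotheses (r0 : 0 < r) (K0 : 0 < K) (t0 : 0 < th) (t1 : th <= 1)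
  (tr : th <= r) (hA : 32 / th <= A).
Hypotheses (hf : forall i, sum_le (f i) r K) (hg0 : sum_le g0 r K)
  (hgz : forall i, sum_le (gz i) r K).
Let c (i : 'I_n.+1) := if i == w then 64 / th else A.
Let z := g0 0%MM.
(** One term for each of the three summands into which [bnd_ghat] splits [ghat s] minus its constant
    term. Neither this constant nor [ehat_bound] involves th or A, so both can be chosen
    afterwards. *)
Definition ghat_bound : R := 8 * K * n%:R + 2 ^+ k * (8 * K) + 8 / r * K.
Definition ehat_bound : R :=
  ghat_bound * k.+2%:R + ghat_bound + ghat_bound + nc z * (1 + k.+2%:R).

Let A0 : 0 < A. Proof. by apply: lt_le_trans hA; rewrite divr_gt0. Qed.
Let c0 i : 0 < c i. Proof. by rewrite /c; case: eqP => // _; rewrite divr_gt0. Qed.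
Let nz0 : 0 < nc z.
Proof.
rewrite lt0r nc_ge0 andbT; apply/eqP => /Normc.eq0_normc e.
by move: g00; rewrite -/z e eqxx.
Qed.

Lemma ghat_bound_ge0 : 0 <= ghat_bound.
Proof.
have [K1 r1] := (ltW K0, ltW r0).
by rewrite /ghat_bound !addr_ge0 // !mulr_ge0 ?exprn_ge0 ?invr_ge0.
Qed.

Lemma bnd_ghat s : bnd c 2 th s -> s 0%MM = 0 ->
  bnd c 2 (th * ghat_bound) (ghat s - cst z).
Proof.
move=> hs s0; have hb := bnd_bl C t0 t1 hA (bnd_le c0 t1 hs).
have nl := bl_nilp C s; have t0' := ltW t0.
have e : ghat s - cst z =
  \sum_(i | i != w) ps_X i * (ps_X w * ps_comp (gz i) (blC s)) +
  ((1 + s) ^+ k - 1) * ps_comp g0 (blC s) + ps_comp (g0 - cst z) (blC s).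
  by rewrite pscompB pscompC /ghat; ring.
rewrite e.
have hX i : bnd c 2 th (ps_X i).
  apply: bnd_le (bndX c0 i) => //.
  rewrite ler_pdivrMr // mulrC -ler_pdivrMr // /c; case: eqP => // _.
  by rewrite ler_pM2r ?invr_gt0 // ler_nat.
have -> : th * ghat_bound = \sum_(i < n) (th * (1 * (8 * K))) + (2 ^+ k * th) * (8 * K) +
   8 * (th / r) * K.
  rewrite sumr_const card_ord /ghat_bound -mulr_natr; field; rewrite gt_eqF //.
apply: bndD; last first.
  apply: (bnd_comp0 c0 r0 _ hb t0' tr); last by rewrite psB /cst eqxx subrr.
  exact: sum_le_sub0 (ltW r0) hg0.
apply: bndD; last first.
  apply: bndM => //; first exact: bndXn_sub1.
  exact: (bnd_comp c0 r0 hg0 hb t0' tr).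
have -> : \sum_(i < n) (th * (1 * (8 * K))) =
    \sum_(i < n.+1 | i != w) (th * (1 * (8 * K))).
  by rewrite !sumr_const card_ord cardC1 card_ord.
apply: bnd_sum => i _; apply: bndM => //; apply: bndM => //.
  exact: bnd_le t1 (hX w).
exact: (bnd_comp c0 r0 (hgz i) hb t0' tr).
Qed.

Lemma bnd_dphi s : bnd c 3 th s -> bnd c 2 (th * (1 + k.+2%:R)) (dphi s - 1).
Proof.
move=> hs; have -> : dphi s - 1 = s + Dw C s by rewrite /dphi; ring.
rewrite mulrDr mulr1 [th * _]mulrC; apply: bndD; first exact: bndS.
exact: bnd_Dw.
Qed.

Lemma bnd_ehat s : bnd c 3 th s -> s 0%MM = 0 ->
  bnd c 2 (th * ehat_bound) (ehat s - cst z).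
Proof.
move=> hs s0; have hG := bnd_ghat (bndS hs) s0; have hx := bnd_dphi hs.
have -> : ehat s - cst z = (ghat s - cst z) * (dphi s - 1) + (ghat s - cst z) +
  cst z * (dphi s - 1) by rewrite /ehat; ring.
apply: bnd_le (bndD (bndD (bndM c0 hG hx) hG) (bnd_cst z hx)) => //.
have G0 := ghat_bound_ge0; rewrite /ehat_bound; set j : R := k.+2%:R.
have j0 : 0 <= j by rewrite ler0n.
have h : 0 <= th * (1 - th) * (ghat_bound * (1 + j)).
  have [h1 h2] : 0 <= th /\ 0 <= 1 - th by rewrite subr_ge0 ltW.
  by rewrite !mulr_ge0 // addr_ge0.
rewrite -subr_ge0; move: h; congr (0 <= _); ring.
Qed.

Lemma bnd_psinv_ehat s : bnd c 3 th s -> s 0%MM = 0 -> th * ehat_bound <= nc z / 2 ->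
  bnd c 2 (nc z^-1 * 24) (psinv (ehat s)).
Proof.
(* [ehat s] divided by its constant term z is 1 - y with y of norm at most 1/2, so the geometric
   bound 24 applies. *)
move=> hs s0 hE; pose y := cst (- z^-1) * (ehat s - cst z).
have y0 : y 0%MM = 0.
  by rewrite /y cstM_coef psB ehat0 // /cst eqxx subrr mulr0.
have h1 : (1 - y) 0%MM != 0 by rewrite psB y0 ps1 eqxx subr0 oner_neq0.
have zz : cst z * cst z^-1 = 1 :> mfps R n.+1.
  by rewrite -rmorphM mulfV //; exact: cst1.
have ey : cst z^-1 * ehat s = 1 - y.
  have -> : y = - (cst z^-1 * ehat s) + cst z * cst z^-1 by rewrite /y cstN; ring.
  by rewrite zz; ring.
have -> : psinv (ehat s) = cst z^-1 * psinv (1 - y).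
  apply: psinv_uniq; rewrite mulrA [ehat s * _]mulrC ey; exact: psinvP.
apply: bnd_cst; apply: (bnd_inv c0 y0 (bnd_cst _ (bnd_ehat hs s0))).
by rewrite ncN Normc.normcV ler_pdivrMl // mul1r.
Qed.

(** The constants bound the three factors: 8 + (1 + k.+2) for [dphi s], 8 K for f composed with the
    blow-up, 24 / |z| for the inverse of [ehat s]. The derivative in [dphi] drops q from 3 to 2 and
    [Einv] restores 3 with the gain 1/A. *)
Lemma bnd_evolution_map s : bnd c 3 th s -> s 0%MM = 0 -> th * ehat_bound <= nc z / 2 ->
  8 * ((8 + (1 + k.+2%:R)) * (8 * K * (nc z^-1 * 24))) <= th * A ->
  bnd c 3 th (evolution_map s).
Proof.
move=> hs s0 hE hA2; rewrite evolution_mapE; apply: bndN.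
set M := (8 + (1 + k.+2%:R)) * (8 * K * (nc z^-1 * 24)) in hA2.
have M0 : 0 <= M by rewrite !mulr_ge0 ?addr_ge0 ?nc_ge0 ?ler0n // ltW.
apply: (bnd_le c0 (th := 8 * M / A)).
  by rewrite ler_pdivrMr.
apply: bnd_Einv => //; first by rewrite divr_gt0.
move=> i hi; apply: (bndM c0).
  have -> : dphi s = 1 + (dphi s - 1) by ring.
  apply: bndD; first exact: bnd1.
  apply: bnd_le (bnd_dphi hs) => //.
  by rewrite ler_piMl // addr_ge0 ?ler0n.
apply: bnd_dg => //.
  by move=> m; rewrite nc_nat lern1 leq_b1.
apply: (bndM c0); last exact: bnd_psinv_ehat.
have hb := bnd_bl C t0 t1 hA (bnd_le c0 t1 (bndS hs)).
exact: (bnd_comp c0 r0 (hf i) hb (ltW t0) tr).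
Qed.

End Bounds.

Lemma evolution_solution : exists s,
  [/\ s 0%MM = 0, inKp C s, De s = - (dphi s * Pp C (log_slope s)) & ps_convergent s].
Proof.
have [s [s0 es hQ]] := contracting_fixpoint (@evolution_contracting R n k f g0 gz g00).
exists s; split=> //.
(* [log_slope] has negative powers of w, but the map only uses its projection; as [inKp] is stable
   under products and [Dw], the iterates remain in it. *)
- apply: (hQ (fun m x => (m w < C * zdeg m)%N -> x = 0)) => // b b0 hb m hm.
  rewrite /evolution_map psN; apply/eqP; rewrite oppr_eq0; apply/eqP; move: m hm.
  apply: inKp_dg; apply: inKpM; last exact: Pp_inKp.
  by apply: inKpD; [apply: inKpD => //; exact: inKp1|exact: inKp_dg].
- rewrite -{1}es /evolution_map; set a := Einv _.
  have -> : De (- a) = - De a.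
    by apply: mfpsP => m; rewrite psN /De /dg psN mulrN.
  rewrite /a De_Einv // /Pp /log_slope dg_sum mulr_sumr.
  apply: (big_ind (@z_multiple R n)) => //; first exact: z_multipleD.
  by move=> i hi; rewrite dg_XM mulrCA; exact: z_multipleX.
pose F (x : 'I_n.+1 + 'I_n.+1 + unit) : mfps R n.+1 :=
  match x with inl (inl i) => f i | inl (inr i) => gz i | inr _ => g0 end.
have cF x : ps_convergent (F x) by case: x => [[i|i]|[]] /=.
have [r [K [r0 K0 hF]]] : exists r K : R, [/\ 0 < r, 0 < K & forall x, sum_le (F x) r K].
  exact: sum_le_family cF.
have hf i : sum_le (f i) r K := hF (inl (inl i)).
have hgz i : sum_le (gz i) r K := hF (inl (inr i)).
have hg0 : sum_le g0 r K := hF (inr tt).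
pose E := ehat_bound r K; pose z : R := nc (g0 0%MM).
have z0 : 0 < z.
  rewrite lt0r nc_ge0 andbT; apply/eqP => /Normc.eq0_normc e.
  by move: g00; rewrite e eqxx.
have E0 : 0 <= E.
  have G0 := ghat_bound_ge0 r0 K0.
  have j0 : 0 <= (k.+2%:R : R) by rewrite ler0n.
  rewrite /E /ehat_bound; move: (ghat_bound r K) G0 => G G0.
  have h1 := mulr_ge0 G0 j0; have h2 := mulr_ge0 (ltW z0) j0.
  by rewrite -/z; have z1 := ltW z0; lra.
(* D = 1/th is a sum of nonnegative terms, one for each of th <= 1, th <= r and th E <= z/2. *)
pose D := 1 + r^-1 + 2 * E / z.
have E1 : 0 <= 2 * E / z by rewrite !mulr_ge0 ?invr_ge0 // ltW.
have r1 : 0 < r^-1 by rewrite invr_gt0.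
have D0 : 0 < D by rewrite /D; lra.
pose th := D^-1.
have t0 : 0 < th by rewrite invr_gt0.
have t1 : th <= 1 by rewrite invf_le1 // /D; lra.
have tr : th <= r by rewrite -[r]invrK lef_pV2 ?posrE // /D; lra.
have tE : th * E <= z / 2.
  rewrite mulrC ler_pdivrMr // mulrAC ler_pdivlMr //.
  have -> : z * D = z + z * r^-1 + 2 * E by rewrite /D; field; rewrite !gt_eqF.
  by have := mulr_gt0 z0 r1; lra.
set M := 8 * ((8 + (1 + k.+2%:R)) * (8 * K * (nc (g0 0%MM)^-1 * 24))) : R.
have M0 : 0 <= M.
  have j0 : 0 <= (k.+2%:R : R) by rewrite ler0n.
  have K1 := ltW K0; have z1 := nc_ge0 (g0 0%MM)^-1.
  by rewrite /M !mulr_ge0 // !addr_ge0.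
(* 32/th serves the composition bounds, M/th the stability of the ball. *)
pose A := (32 + M) / th.
have hA : 32 / th <= A by rewrite ler_pM2r ?invr_gt0 // lerDl.
have hMA : M <= th * A by rewrite mulrC divfK ?gt_eqF // lerDr.
pose c (i : 'I_n.+1) := if i == w then 64 / th else A.
have c0 i : 0 < c i.
  rewrite /c; case: eqP => _; first by rewrite divr_gt0.
  by apply: lt_le_trans hA; rewrite divr_gt0.
apply: (bnd_convergent c0 (q := 3) (th := th)) => m.
apply: (hQ (fun m x => nc x <= th / 8 * (mdeg m).+1%:R ^- 3 * lam c m)).
  by move=> p; rewrite nc0 !mulr_ge0 ?wq_ge0 ?lam_ge0 ?invr_ge0 // ltW.
move=> b b0 hb.
exact: (bnd_evolution_map r0 K0 t0 t1 tr hA hf hg0 hgz hb b0 tE hMA).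
Qed.

End Existence.

(** * Invertibility of the coordinate change *)

Section InverseMap.
Variables (R : realType) (n : nat).
Local Notation w := (ord_max : 'I_n.+1).
Local Notation nc := Normc.normc.
Implicit Types (U b s : mfps R n.+1).

Lemma w_map_bl U : w_map (ps_X w * (1 + U)) = bl 0 U.
Proof.
by apply: funext => i; rewrite /w_map /bl; case: eqP => // _; rewrite expr0 mulr1.
Qed.

(** For the inverse sought as (z, w (1 + b)), the equation is (1 + b) (1 + U (z, w (1 + b))) = 1.
    Inside U, b is multiplied by w, which gains one degree. *)
Lemma inverse_contracting U : U 0%MM = 0 ->
  contracting (fun b => - (ps_comp U (bl 0 b) * (1 + b))).
Proof.
move=> U0; have c0 b : ps_comp U (bl 0 b) 0%MM = 0.
  by rewrite pscomp_coef0 //; apply: bl_nilp.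
split=> [b _|d b b' _ _ h]; first by rewrite psN psM0 c0 mul0r oppr0.
have h1 : eqd d.+1 (ps_comp U (bl 0 b)) (ps_comp U (bl 0 b')).
  by apply: eqd_comp => // i; apply: eqd_bl.
apply: eqdN; apply: eqd_trans (eqdM h1 (@eqd_refl _ _ _ _)) _.
by rewrite -[d.+1]addn1; apply: eqdMl; [apply: eqd1_0|apply: eqdD].
Qed.

Lemma right_inverse U : U 0%MM = 0 -> exists b,
  [/\ b 0%MM = 0, forall i, ps_comp (bl 0 U i) (bl 0 b) = ps_X i &
    ps_convergent U -> ps_convergent b].
Proof.
move=> U0; have [b [b0 eb hQ]] := contracting_fixpoint (inverse_contracting U0).
exists b; split=> // [i|cU].
  have nl := @bl_nilp R n 0 b.
  case: (altP (i =P w)) => [->|hi]; last first.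
    by rewrite !bl_z // expr0 mulr1 pscomp_X // bl_z // expr0 mulr1.
  rewrite bl_w pscompM // pscomp_X // bl_w pscompD pscomp1 -mulrA.
  rewrite -[RHS]mulr1; congr (_ * _).
  have e : 1 + b = 1 - ps_comp U (bl 0 b) * (1 + b) by rewrite -{1}eb.
  by rewrite mulrDr mulr1 {1}e [(1 + b) * _]mulrC subrK.
have [r [K [r0 K0 hU]]] := convergent_sum_le cU.
(* 72 = 8 (8 + 1): the composite of U has norm at most 8 (th/r) K, and 1 + b at most 8 + 1. *)
pose D := 1 + r^-1 + 72 * K / r.
have r1 : 0 < r^-1 by rewrite invr_gt0.
have K1 : 0 <= 72 * K / r by rewrite !mulr_ge0 // ltW.
have D0 : 0 < D by rewrite /D; lra.
pose th := D^-1.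
have t0 : 0 < th by rewrite invr_gt0.
have t1 : th <= 1 by rewrite invf_le1 // /D; lra.
have tr : th <= r by rewrite -[r]invrK lef_pV2 ?posrE // /D; lra.
have tK : 72 * (th / r) * K <= 1.
  have -> : 72 * (th / r) * K = (72 * K / r) * th by ring.
  by rewrite ler_pdivrMr // mul1r /D; lra.
pose c (i : 'I_n.+1) := if i == w then 64 / th else 32 / th.
have c0 i : 0 < c i by rewrite /c; case: eqP => _; rewrite divr_gt0.
apply: (bnd_convergent c0 (q := 2) (th := 1)) => m.
apply: (hQ (fun m x => nc x <= 1 / 8 * (mdeg m).+1%:R ^- 2 * lam c m)).
  by move=> p; rewrite nc0 !mulr_ge0 ?wq_ge0 ?lam_ge0 ?invr_ge0.
move=> b' _ hb'; apply: bndN.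
have h1 := bnd_comp0 c0 r0 hU (bnd_bl 0 t0 t1 (lexx _) hb') (ltW t0) tr U0.
apply: bnd_le (bndM c0 h1 (bndD (bnd1 c0 2) hb')) => //.
by lra.
Qed.

Lemma biholomorphism_bl U : ps_convergent U -> U 0%MM = 0 ->
  germ_biholomorphism (w_map (ps_X w * (1 + U))).
Proof.
move=> cU U0; rewrite w_map_bl.
have gm V : V 0%MM = 0 -> ps_convergent V -> germ_map (bl 0 V).
  move=> V0 cV i; split; last exact: bl_nilp.
  rewrite /bl; case: eqP => _.
    apply: convergentM; first exact: convergent_psX.
    by apply: convergentD => //; rewrite -cst1; apply: convergent_cst.
  by rewrite expr0 mulr1; apply: convergent_psX.
have [b [b0 eb cb]] := right_inverse U0.
have [b' [b0' eb' _]] := right_inverse b0.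
(* The right inverse b itself has a right inverse b', and associativity forces b' to be the original
   map; b is therefore two-sided. *)
have e i : bl 0 U i = bl 0 b' i.
  rewrite -[LHS]pscomp_id.
  have -> : @ps_X R n.+1 = fun j => ps_comp (bl 0 b j) (bl 0 b').
    by apply: funext => j; rewrite eb'.
  rewrite -pscompA ?eb //; try exact: bl_nilp.
  by rewrite pscomp_X //; apply: bl_nilp.
split; first exact: gm.
exists (bl 0 b); split; first by apply: gm => //; apply: cb.
move=> i; split; first exact: eb.
by rewrite -[RHS]eb'; congr ps_comp; apply: funext.
Qed.

End InverseMap.

(** * Integrability in the new coordinate *)

Section Pullback.
Variables (R : realType) (n : nat).
Local Notation w := (ord_max : 'I_n.+1).
Implicit Types (a f phi : mfps R n.+1) (Theta : 'I_n.+1 -> mfps R n.+1).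

Lemma w_map_nilp phi : phi 0%MM = 0 -> nilp_map (w_map phi).
Proof. by move=> h i; rewrite /w_map; case: eqP => // _; rewrite psX0. Qed.

Lemma w_map_w phi : w_map phi w = phi. Proof. by rewrite /w_map eqxx. Qed.
Lemma w_map_z phi i : i != w -> w_map phi i = ps_X i.
Proof. by rewrite /w_map => /negbTE ->. Qed.

Lemma sum_deriv_w_map (phi : mfps R n.+1) (b : 'I_n.+1 -> mfps R n.+1) j :
  \sum_i b i * ps_deriv j (w_map phi i) =
  (if j == w then 0 else b j) + b w * ps_deriv j phi.
Proof.
rewrite (bigD1 w) //= w_map_w addrC; congr (_ + _).
rewrite (eq_bigr (fun i => if i == j then b i else 0)); last first.
  move=> i hi; rewrite w_map_z // psderiv_X eq_sym.
  by case: eqP; rewrite ?mulr1 ?mulr0.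
case: (altP (j =P w)) => [->|hj]; first by rewrite big1 // => i /negbTE ->.
rewrite (bigD1 j) //= eqxx big1 ?addr0 // => i /andP[_ ij].
by rewrite (negbTE ij).
Qed.

Lemma chain_rule_w_map phi f j : phi 0%MM = 0 ->
  ps_deriv j (ps_comp f (w_map phi)) =
  (if j == w then 0 else ps_comp (ps_deriv j f) (w_map phi)) +
  ps_comp (ps_deriv w f) (w_map phi) * ps_deriv j phi.
Proof.
move=> h; rewrite psderiv_comp; last exact: w_map_nilp.
by rewrite (sum_deriv_w_map phi (fun i => ps_comp (ps_deriv i f) (w_map phi))).
Qed.

Lemma pullback_w_map phi Theta j : form_pullback (w_map phi) Theta j =
  (if j == w then 0 else ps_comp (Theta j) (w_map phi)) +
  ps_comp (Theta w) (w_map phi) * ps_deriv j phi.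
Proof.
rewrite -(sum_deriv_w_map phi (fun i => ps_comp (Theta i) (w_map phi))).
by apply: mfpsP => m; rewrite ps_sumE.
Qed.

(** Since dz_i and dz_j are unchanged, the (i, j, w) coefficient of the pulled-back 3-form is phi_w
    times the composite of the original one; the second derivatives of phi cancel. *)
Lemma integrable_pullback phi Theta i j : phi 0%MM = 0 ->
  integrable_form Theta -> i != w -> j != w ->
  let F := form_pullback (w_map phi) Theta in
  F i * (ps_deriv j (F w) - ps_deriv w (F j)) +
  F j * (ps_deriv w (F i) - ps_deriv i (F w)) +
  F w * (ps_deriv i (F j) - ps_deriv j (F i)) = 0.
Proof.
move=> h int hi hj F.
have I : Theta i * (ps_deriv j (Theta w) - ps_deriv w (Theta j)) +
    Theta j * (ps_deriv w (Theta i) - ps_deriv i (Theta w)) +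
    Theta w * (ps_deriv i (Theta j) - ps_deriv j (Theta i)) = 0 := int i j w.
have nl := w_map_nilp h.
have := congr1 (fun f => ps_comp f (w_map phi)) I.
rewrite pscomp0 !pscompD !pscompM // !pscompB => {}I.
rewrite /F !pullback_w_map eqxx (negbTE hi) (negbTE hj) add0r.
rewrite !psderivD !psderivM !chain_rule_w_map // eqxx (negbTE hi) (negbTE hj).
rewrite !add0r (psderiv_comm i w) (psderiv_comm j w) (psderiv_comm j i).
move: I.
set ti := ps_comp (Theta i) _; set tj := ps_comp (Theta j) _.
set tw := ps_comp (Theta w) _.
set p1 := ps_comp (ps_deriv j (Theta w)) _.
set p2 := ps_comp (ps_deriv w (Theta j)) _.
set p3 := ps_comp (ps_deriv w (Theta i)) _.
set p4 := ps_comp (ps_deriv i (Theta w)) _.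
set p5 := ps_comp (ps_deriv i (Theta j)) _.
set p6 := ps_comp (ps_deriv j (Theta i)) _.
set p7 := ps_comp (ps_deriv w (Theta w)) _.
move: (ps_deriv w phi) (ps_deriv i phi) (ps_deriv j phi)
  (ps_deriv w (ps_deriv w phi)) (ps_deriv w (ps_deriv i phi))
  (ps_deriv w (ps_deriv j phi)) (ps_deriv i (ps_deriv j phi))
  => fw fi fj fww fwi fwj fij.
move=> I; rewrite -(mulr0 fw) -I; ring.
Qed.

Lemma delta_X i j a : i != j ->
  dg (fun m => (m i)%:R) (ps_X j * a) = ps_X j * dg (fun m => (m i)%:R) a.
Proof.
move=> ij; rewrite dgM; last by move=> m1 m2; rewrite mnmDE natrD.
rewrite dg_X mnm1E eq_sym (negbTE ij) /=.
have -> : cst 0 = 0 :> mfps R n.+1 by rewrite rmorph0.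
by rewrite !mul0r add0r.
Qed.

(** The same relation times x_i x_j x_w, for the coefficients on dx_l / x_l. The operators x_l
    d/dx_l are diagonal and carry over to blown-up coordinates. *)
Lemma integrable_log phi Theta i j : phi 0%MM = 0 ->
  integrable_form Theta -> i != w -> j != w ->
  let F := form_pullback (w_map phi) Theta in
  let d l := dg (fun m : 'X_{1..n.+1} => (m l)%:R) in
  let p l := ps_X l * F l in
  p i * (d j (p w) - d w (p j)) + p j * (d w (p i) - d i (p w)) +
  p w * (d i (p j) - d j (p i)) = 0.
Proof.
move=> h int hi hj F d p.
case: (altP (i =P j)) => [->|ij]; first by ring.
have I := integrable_pullback h int hi hj; rewrite -/F in I.
rewrite /d /p !delta_X // 1?eq_sym // -!X_deriv.
rewrite -(mulr0 (ps_X i * ps_X j * ps_X w)) -I; ring.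
Qed.

End Pullback.

(** * Integrability of the blown-up slopes *)

Section BlownUpForm.
Variables (R : realType) (n k : nat).
Local Notation w := (ord_max : 'I_n.+1).
Local Notation C := k.+1.
Local Notation blC := (@bl R n C).
Local Notation beta := (@beta R n C).
Implicit Types (a b f s U : mfps R n.+1) (m : 'X_{1..n.+1}).

Lemma psXn_inj e : injective (fun a => ps_X w ^+ e * a).
Proof.
elim: e => [|e IH] a b /=; first by rewrite expr0 !mul1r.
by rewrite exprS -!mulrA => /psX_inj /IH.
Qed.

Lemma beta_X i : i != w -> beta (ps_X i) = ps_X i * ps_X w ^+ C.
Proof. by move=> hi; rewrite /beta pscomp_X ?bl_z //; apply: bl_nilp. Qed.

Lemma beta_Xw : beta (ps_X w) = ps_X w.
Proof. by rewrite /beta pscomp_X ?bl_w ?addr0 ?mulr1 //; apply: bl_nilp. Qed.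

Lemma betaB f a : beta (f - a) = beta f - beta a.
Proof. exact: pscompB. Qed.

Lemma beta1 : beta 1 = 1. Proof. exact: pscomp1. Qed.

Lemma beta0 : beta 0 = 0. Proof. exact: pscomp0. Qed.

Lemma beta_comp f U : U 0%MM = 0 ->
  beta (ps_comp f (w_map (ps_X w * (1 + U)))) = ps_comp f (blC (beta U)).
Proof.
move=> U0; have nl := @bl_nilp R n C 0.
rewrite /beta pscompA //; last by apply: w_map_nilp; rewrite psM0 psX0 mul0r.
congr ps_comp; apply: funext => i; rewrite /w_map.
case: (altP (i =P w)) => [->|hi].
  by rewrite pscompM // pscomp_X // !bl_w addr0 mulr1 pscompD pscomp1.
by rewrite pscomp_X // !bl_z.
Qed.

Lemma Dw_Xw a : Dw C (ps_X w * a) = ps_X w * (a + Dw C a).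
Proof.
rewrite DwM mulrDr; congr (_ * _ + _); rewrite /Dw dg_X mnm1E eqxx.
have -> : zdeg U_(w) = 0%N by rewrite zdegU eqxx.
by rewrite muln0 subr0 cst1 mul1r.
Qed.

Lemma DiXw i a : i != w -> Di i (ps_X w * a) = ps_X w * Di i a.
Proof. exact: delta_X. Qed.

(** Summed over j, the relations become E h_i = D_i H + H D_w h_i - h_i D_w H, where H is the sum of
    the h_j. As H has only negative powers of w, this is a recursion on the z-degree for the
    nonnegative part of h_i. *)
Lemma inKm_log_integrable (h : 'I_n.+1 -> mfps R n.+1) :
  (forall i, i != w -> z_multiple (h i)) ->
  (forall i j, i != w -> j != w ->
    h j * Dw C (h i) - h i * Dw C (h j) + (Di i (h j) - Di j (h i)) = 0) ->
  inKm C (\sum_(j | j != w) h j) -> forall i, i != w -> inKm C (h i).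
Proof.
move=> hz hint; set H := \sum_(j | j != w) h j => hH i hi.
have e : De (h i) = Di i H + H * Dw C (h i) - h i * Dw C H.
  apply/eqP; rewrite eq_sym -subr_eq0; apply/eqP.
  have -> : De (h i) = \sum_(j | j != w) Di j (h i) by apply: De_sum.
  rewrite /H /Di /Dw !dg_sum mulr_suml mulr_sumr -!sumrN -!big_split /=.
  apply: big1 => j hj; rewrite -[RHS](hint i j hi hj) /Di /Dw; ring.
move=> m; move: {2}(zdeg m).+1 (ltnSn (zdeg m)) => d; elim: d m => // d IH m hd hm.
have [/eqP z0|z0] := boolP (zdeg m == 0%N); first by apply: hz.
(* Every monomial of an element of [inKm] has positive z-degree, so only the part of b of z-degree
   below that of m enters, where the induction hypothesis applies. *)
have V a b : inKm C a -> (forall p, (zdeg p < zdeg m)%N ->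
    (C * zdeg p <= p w)%N -> b p = 0) -> (a * b) m = 0.
  move=> ha hb; rewrite -ps_mulE /ps_mul big1 // => q /eqP mq.
  case: (leqP (C * zdeg q.1) ((q.1 : 'X_{1..n.+1}) w)) => h1.
    by rewrite ha ?mul0r.
  have := congr1 (@zdeg n) mq; have := congr1 (fun x : 'X_{1..n.+1} => x w) mq.
  rewrite /= zdegD mnmDE => e1 e2.
  rewrite hb ?mulr0 //.
    rewrite [X in (_ < X)%N]e2 -[ltnLHS]add0n ltn_add2r.
    by move: h1; case: (zdeg q.1); rewrite ?muln0.
  move: hm; rewrite [X in (C * X)%N]e2 [leqRHS]e1 mulnDr => hm.
  move: hm h1; move: (C * zdeg q.1)%N (C * zdeg q.2)%N => x y.
  by move: (fun_of_multinom q.1 w) (fun_of_multinom q.2 w) => u v; lia.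
have hlow p : (zdeg p < zdeg m)%N -> (C * zdeg p <= p w)%N -> h i p = 0.
  by move=> h1 h2; apply: IH => //; apply: leq_trans h1 _; rewrite -ltnS.
have := congr1 (fun f : mfps R n.+1 => f m) e.
rewrite psB psD /De {1}/dg V //; last first.
  by move=> p h1 h2; rewrite /Dw /dg hlow ?mulr0.
rewrite [h i * _]mulrC V //; last exact: inKm_dg.
rewrite /Di (inKm_dg _ hH) // addr0 subr0 => /eqP.
by rewrite mulf_eq0 pnatr_eq0 (negbTE z0) => /eqP.
Qed.

End BlownUpForm.

(** * Normalized coordinate and Weierstrass factor *)

Section Normalization.
Variables (R : realType) (n k : nat).
Local Notation w := (ord_max : 'I_n.+1).
Local Notation C := k.+1.
Local Notation blC := (@bl R n C).
Local Notation beta := (@beta R n C).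
Local Notation nc := Normc.normc.
Implicit Types (a b f s U : mfps R n.+1) (m : 'X_{1..n.+1}).

Lemma beta_log i j (qi qj qw : mfps R n.+1) : i != w -> j != w ->
  let d l := dg (fun m : 'X_{1..n.+1} => (m l)%:R) in
  qi * (d j qw - d w qj) + qj * (d w qi - d i qw) + qw * (d i qj - d j qi) = 0 ->
  beta qi * (Di j (beta qw) - Dw C (beta qj)) +
  beta qj * (Dw C (beta qi) - Di i (beta qw)) +
  beta qw * (Di i (beta qj) - Di j (beta qi)) = 0.
Proof.
move=> hi hj d /(congr1 beta); rewrite beta0 => <-.
by rewrite !(betaB, betaD, betaM) -!beta_Di // -!beta_Dw.
Qed.

Lemma convergent_gamma a : ps_convergent a -> ps_convergent (gamma C a).
Proof.
move=> ca; apply: (@convergent_shift _ _ a _ C.+1 0 (raise C)) => // m.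
rewrite !mdeg_zdeg zdeg_raise raise_w; nia.
Qed.

Lemma holomorphic_pullback phi (Theta : 'I_n.+1 -> mfps R n.+1) :
  ps_convergent phi -> phi 0%MM = 0 -> holomorphic_form Theta ->
  holomorphic_form (form_pullback (w_map phi) Theta).
Proof.
move=> cphi phi0 hT j; rewrite pullback_w_map.
have cw i : ps_convergent (w_map phi i).
  by rewrite /w_map; case: eqP => // _; apply: convergent_psX.
have cc i : ps_convergent (ps_comp (Theta i) (w_map phi)).
  by apply: convergent_comp => //; apply: w_map_nilp.
apply: convergentD; first by case: eqP => // _; apply: convergent0.
by apply: convergentM => //; apply: convergent_deriv.
Qed.

(** The series in the last clause are the logarithmic slopes z_i F_i / (w F_w) in blown-up
    coordinates: numerator and denominator both carry w^(k+1), and [e] is the unit left in the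
    denominator. *)
Lemma normalized_coordinate (Theta : 'I_n.+1 -> mfps R n.+1) :
  holomorphic_form Theta -> integrable_form Theta ->
  w_order_at k (Theta w) ->
  exists U e : mfps R n.+1,
    let F := form_pullback (w_map (ps_X w * (1 + U))) Theta in
    [/\ U 0%MM = 0, ps_convergent U, e 0%MM != 0,
        beta (ps_X w * F w) = ps_X w ^+ C * e &
        forall i, i != w -> inKm C (ps_X i * beta (F i) * psinv e)].
Proof.
move=> hT int hord.
have [g0 [gz [cg0 cgz g00 eg]]] := regular_decomposition (hT w) hord.
have [s [s0 sK es cs]] := evolution_solution k hT cg0 cgz g00.
set e := ehat k g0 gz s; pose U := gamma C s.
have bU : beta U = s by apply: gammaK.
have r0 : raise C (0%MM : 'X_{1..n.+1}) = 0%MM.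
  apply/mnmP => i; rewrite mnmE !mnm0E /zdeg big1 => [|j _]; last by rewrite mnm0E.
  by rewrite muln0 addn0; case: eqP.
have U0 : U 0%MM = 0 by rewrite /U /gamma r0.
exists U, e => F.
pose phi := ps_X w * (1 + U).
have phi0 : phi 0%MM = 0 by rewrite /phi psM0 psX0 mul0r.
have bphi : beta phi = ps_X w * (1 + s).
  by rewrite betaM beta_Xw betaD beta1 bU.
have bg : beta (ps_comp (Theta w) (w_map phi)) = ps_X w ^+ k * ghat k g0 gz s.
  by rewrite beta_comp // bU ghatE -eg.
have Dw1 : Dw C (1 + s) = Dw C s.
  rewrite /Dw dgD -[RHS]add0r; congr (_ + _).
  apply: mfpsP => m; rewrite /dg ps1 ps0; case: eqP => [->|]; rewrite ?mulr0 //.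
  by rewrite mnm0E zdeg0 muln0 subrr mul0r.
have Di1 i : Di i (1 + s) = Di i s.
  rewrite /Di dgD -[RHS]add0r; congr (_ + _).
  apply: mfpsP => m; rewrite /dg ps1 ps0; case: eqP => [->|]; rewrite ?mulr0 //.
  by rewrite mnm0E mul0r.
have eFw : beta (ps_X w * F w) = ps_X w ^+ C * e.
  rewrite /F -/phi pullback_w_map eqxx add0r mulrCA X_deriv betaM bg.
  by rewrite beta_Dw bphi Dw_Xw Dw1 exprSr /e /ehat /dphi; ring.
(* The coefficient of the pullback, times z_i and divided by w^(k+1): in the second summand w^k
   comes from g and the last w from phi = w (1 + s). *)
have eFi i : i != w ->
    ps_X i * beta (F i) =
    ps_X i * ps_comp (Theta i) (blC s) + ghat k g0 gz s * Di i s.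
  move=> hi; apply: (@psXn_inj R n C) => /=.
  have -> : ps_X w ^+ C * (ps_X i * beta (F i)) = beta (ps_X i * F i).
    by rewrite betaM beta_X //; ring.
  rewrite /F -/phi pullback_w_map (negbTE hi) mulrDr betaD [X in _ + X](_ : _ =
    beta (ps_comp (Theta w) (w_map phi) * (ps_X i * ps_deriv i phi))); last first.
    by congr beta; ring.
  rewrite X_deriv [beta (_ * dg _ _)]betaM bg betaM beta_comp // bU beta_X //.
  rewrite -/(Di i phi) beta_Di // bphi DiXw // Di1 !exprSr; ring.
have e0 : e 0%MM != 0 by rewrite /e ehat0.
have ei : e * psinv e = 1 by apply: psinvP.
pose h i := ps_X i * beta (F i) * psinv e.
have hN i : i != w -> beta (ps_X i * F i) = ps_X w ^+ C * e * h i.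
  move=> hi; rewrite betaM beta_X // /h.
  have -> : ps_X w ^+ C * e * (ps_X i * beta (F i) * psinv e) =
    ps_X w ^+ C * (ps_X i * beta (F i)) * (e * psinv e) by ring.
  by rewrite ei; ring.
(* The relation is quadratic in the coefficients, hence the square of N = w^(k+1) e. N is not a
   unit, so its powers of w and its unit are cancelled separately. *)
have N_cancel a b : ps_X w ^+ C * e * (ps_X w ^+ C * e) * a =
    ps_X w ^+ C * e * (ps_X w ^+ C * e) * b -> a = b.
  have -> : ps_X w ^+ C * e * (ps_X w ^+ C * e) * a =
    ps_X w ^+ C * (e * (ps_X w ^+ C * (e * a))) by ring.
  have -> : ps_X w ^+ C * e * (ps_X w ^+ C * e) * b =
    ps_X w ^+ C * (e * (ps_X w ^+ C * (e * b))) by ring.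
  by move=> /psXn_inj /(unit_cancel e0) /psXn_inj /(unit_cancel e0).
split=> //; first exact: convergent_gamma.
apply: (@inKm_log_integrable R n k h).
- by move=> i hi; rewrite /h -mulrA; apply: z_multipleX.
- move=> i j hi hj; apply: N_cancel; rewrite mulr0.
  have := beta_log hi hj (integrable_log phi0 int hi hj).
  rewrite -/F eFw !hN //; set N := ps_X w ^+ C * e.
  rewrite /Di /Dw !dgM; try by move=> m1 m2; rewrite ?mnmDE ?zdegD ?mulnDr !natrD //; ring.
  rewrite -/(Dw C N) -/(Dw C (h i)) -/(Dw C (h j)) => E.
  rewrite -E; ring.
(* Summing [eFi] produces [ghat] times E s, and the evolution equation replaces it by - [ehat] times
   the projected slope. *)
have -> : \sum_(j | j != w) h j =
    log_slope k Theta g0 gz s - Pp C (log_slope k Theta g0 gz s).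
  apply: (unit_cancel e0); rewrite mulr_sumr.
  rewrite (eq_bigr (fun j => ps_X j * beta (F j))); last first.
    by move=> j _; rewrite /h mulrCA ei mulr1.
  rewrite (eq_bigr _ eFi) big_split /= -mulr_sumr -De_sum es mulrBr.
  congr (_ + _); last by rewrite /e /ehat; ring.
  rewrite /log_slope mulr_sumr; apply: eq_bigr => j _.
  by rewrite -/e -[LHS]mulr1 -ei; ring.
exact: Pm_inKm.
Qed.

(** A factorization of Birkhoff type: p = - P_-((v - 1) (1 + p)), with P_- the projection onto
    negative powers of w. The condition v (0) = 1 makes this a contraction. *)
Lemma weierstrass_factor (v : mfps R n.+1) : ps_convergent v -> v 0%MM = 1 -> exists p,
  [/\ ps_convergent p, inKm C p & inKp C (v * (1 + p))].
Proof.
move=> cv v0; pose y (b : mfps R n.+1) := (v - 1) * (1 + b).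
pose Phi b := - (y b - Pp C (y b)).
have u0 : (v - 1) 0%MM = 0 by rewrite psB v0 ps1 eqxx subrr.
have cPhi : contracting Phi.
  split=> [b _|d a b _ _ h].
    by rewrite /Phi /y psN psB /Pp /dg psM0 u0 mul0r mulr0 subrr oppr0.
  apply: eqdN; have hy : eqd d.+1 (y a) (y b).
    by rewrite -[d.+1]addn1; apply: eqdMl; [apply: eqd1_0|apply: eqdD].
  by apply: eqdD => //; apply: eqdN; apply: eqd_dg.
have [p [p0 ep hQ]] := contracting_fixpoint cPhi.
exists p; split.
- have cu : ps_convergent (v - 1).
    by apply: convergentD => //; rewrite -cst1 -cstN; apply: convergent_cst.
  (* (8 + 1) / 16 <= 1, so the unit ball is stable. *)
  have e0 : 0 < 1 / 16 :> R by rewrite divr_gt0.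
  have [r [r0 hr]] := convergent_bnd_small cu u0 e0.
  pose c (i : 'I_n.+1) := r; have c0 i : 0 < c i by [].
  apply: (bnd_convergent c0 (q := 2) (th := 1)) => m.
  apply: (hQ (fun m x => nc x <= 1 / 8 * (mdeg m).+1%:R ^- 2 * lam c m)).
    by move=> q; rewrite nc0 !mulr_ge0 ?wq_ge0 ?lam_ge0 ?invr_ge0.
  move=> b _ hb; apply: bndN.
  have -> : y b - Pp C (y b) = dg (fun m => (m w < C * zdeg m)%N%:R) (y b).
    apply: mfpsP => q; rewrite psB /Pp /dg leqNgt.
    by case: ltnP; rewrite ?mul0r ?mul1r ?subr0 ?subrr.
  apply: bnd_dg; first by move=> q; rewrite nc_nat lern1 leq_b1.
  apply: bnd_le (bndM c0 (hr c (fun=> lexx _)) (bndD (bnd1 c0 2) hb)) => //.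
  by lra.
- by move=> m hm; rewrite -ep /Phi psN Pm_inKm ?oppr0.
have -> : v * (1 + p) = 1 + Pp C (y p).
  have -> : v * (1 + p) = 1 + p + y p by rewrite /y; ring.
  by rewrite -{1}ep /Phi; ring.
by apply: inKpD; [exact: inKp1|exact: Pp_inKp].
Qed.

End Normalization.

(** * Polynomiality of the normalized form *)

Theorem theorem1 (R : realType) (n : nat) (Theta : 'I_n.+1 -> mfps R n.+1)
    (k : nat) :
  (1 <= n)%N ->
  holomorphic_form Theta ->
  (exists i, Theta i <> ps_zero) ->
  integrable_form Theta ->
  (1 <= k)%N ->
  w_order_at k (Theta ord_max) ->
  exists phi : mfps R n.+1,
    germ_biholomorphism (w_map phi) /\
    exists Theta' : 'I_n.+1 -> mfps R n.+1,
      [/\ holomorphic_form Theta',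
          forall i, w_degree_le k (Theta' i),
          w_monic (Theta' ord_max) &
          same_foliation (form_pullback (w_map phi) Theta) Theta'].
Proof.
move=> _ hT _ int _ hord; pose w := ord_max : 'I_n.+1.
have [U [e /= [U0 cU e0 eG hK]]] := normalized_coordinate hT int hord.
exists (ps_X w * (1 + U)); split; first exact: biholomorphism_bl.
have cphi : ps_convergent (ps_X w * (1 + U)).
  apply: convergentM; first exact: convergent_psX.
  by apply: convergentD => //; rewrite -cst1; apply: convergent_cst.
have phi0 : (ps_X w * (1 + U)) 0%MM = 0 by rewrite psM0 psX0 mul0r.
have cF := holomorphic_pullback cphi phi0 hT.
move: cF eG hK; set F := form_pullback _ _ => cF eG hK.
have bFw : beta k.+1 (F w) = ps_X w ^+ k * e.
  by apply: (@psX_inj _ _ w); rewrite mulrA -exprS -eG betaM beta_Xw.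
have ce : ps_convergent e.
  have cb : ps_convergent (beta k.+1 (F w)).
    apply: convergent_comp; [exact: cF| |exact: bl_nilp] => i.
    rewrite /bl; case: eqP => _.
      by rewrite addr0 mulr1; exact: convergent_psX.
    apply: convergentM; first exact: convergent_psX.
    by apply: convergentXn; apply: convergent_psX.
  apply: (@convergent_shift _ _ _ _ 1 k (fun m => (m + w_pow n k)%MM) cb) => m.
    by rewrite mdegD /w_pow mdegMn mdeg1 !mul1n.
  rewrite bFw w_coef_monomial mnmDE {1}/w_pow mulmnE mnm1E eqxx mul1n leq_addl.
  by rewrite addmK.
pose v := cst (e 0%MM) * psinv e.
have v0 : v 0%MM = 1 by rewrite /v cstM_coef psinv0 // mulfV.
have cv : ps_convergent v.
  by apply: convergentM; [exact: convergent_cst|exact: convergent_inv].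
have [p [cp pK vK]] := weierstrass_factor k cv v0.
(* The multiplier of the form. Up to the constant e (0) the product is v (1 + p), without negative
   powers of w, so it comes from a germ in (z, w). *)
pose a := gamma k.+1 (psinv e * (1 + p)).
have ei : e * psinv e = 1 by apply: psinvP.
have ba : beta k.+1 a = psinv e * (1 + p).
  apply: gammaK => m hm.
  have -> : psinv e * (1 + p) = cst (e 0%MM)^-1 * (v * (1 + p)).
    rewrite /v !mulrA -rmorphM mulVf // rmorph1 mul1r //.
  by rewrite cstM_coef vK // mulr0.
have ca : ps_convergent a.
  apply: convergent_gamma; apply: convergentM; first exact: convergent_inv.
  by apply: convergentD => //; rewrite -cst1; apply: convergent_cst.
(* Since p has only negative powers of w, w^k (1 + p) is w^k plus terms of exponent below k: monic
   of degree k. *)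
have bQ : beta k.+1 (a * F w) = ps_X w ^+ k * (1 + p).
  by rewrite betaM ba bFw -[RHS]mulr1 -ei; ring.
have Qc m : (a * F w) m = if (k <= m w + k.+1 * zdeg m)%N
    then (1 + p) (raise k.+1 m - w_pow n k)%MM else 0.
  by rewrite -[a * F w](betaK k.+1) bQ /gamma w_coef_monomial raise_w.
have zr m : zdeg (raise k.+1 m - w_pow n k)%MM = zdeg m.
  apply: eq_bigr => i hi; rewrite mnmBE /w_pow mulmnE mnm1E eq_sym.
  by rewrite (negbTE hi) mul0n subn0 mnmE (negbTE hi).
have wr m : (raise k.+1 m - w_pow n k)%MM w = (m w + k.+1 * zdeg m - k)%N.
  by rewrite mnmBE raise_w /w_pow mulmnE mnm1E eqxx mul1n.
have Qk (m : 'X_{1..n.+1}) : m w = k -> (a * F w) m = (m == w_pow n k)%:R.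
  move=> mk; rewrite Qc mk leq_addr psD pK ?addr0; last first.
    by rewrite zr wr mk addKn.
  rewrite ps1; congr (nat_of_bool _)%:R; apply/eqP/eqP => [h|->].
    have z0 : zdeg m = 0%N by rewrite -zr h zdeg0.
    apply/mnmP => i; rewrite /w_pow mulmnE mnm1E.
    case: eqP => [<-|/eqP hi]; first by rewrite mk mul1n.
    move/eqP: z0; rewrite sum_nat_eq0 => /forallP /(_ i) /implyP.
    by rewrite eq_sym hi => /(_ isT) /eqP.
  apply/mnmP => i; rewrite mnmBE mnmE.
  have -> : zdeg (w_pow n k) = 0%N.
    rewrite /zdeg big1 // => j hj.
    by rewrite /w_pow mulmnE mnm1E eq_sym (negbTE hj).
  by rewrite muln0 addn0 if_same subnn mnm0E.
have Qd : w_degree_le k (a * F w).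
  move=> m hm; rewrite Qc; case: ifP => // _.
  rewrite psD pK; last by rewrite zr wr; move: hm; move: (m ord_max) => u; lia.
  rewrite addr0 ps1; case: eqP => // h; have := wr m.
  by rewrite h mnm0E; move: hm; rewrite -/w; move: (m w) => u; lia.
exists (fun i => a * F i); split.
- by move=> i; apply: convergentM.
- move=> i; case: (altP (i =P w)) => [->//|hi] m hm.
  (* The variable z'_i stands for z_i w^-(k+1): once it is reinserted, negativity of the exponents
     says that those of w in a F_i are below k + 1. *)
  rewrite -[a * F i](betaK k.+1) /gamma -(psXM_shift i).
  have -> : ps_X i * beta k.+1 (a * F i) =
      ps_X i * beta k.+1 (F i) * psinv e * (1 + p).
    by rewrite betaM ba; ring.
  have hKi := hK i hi; rewrite mulrDr mulr1 (inKmD (C := k.+1)) //; first exact: inKmM.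
  rewrite zdegD zdegU hi mnmDE mnm1E (negbTE hi) addn0 zdeg_raise raise_w.
  by rewrite mulnDr muln1 addnC leq_add2r.
- by exists k; split.
exists a, 1; split=> //.
- by rewrite -cst1; apply: convergent_cst.
(* The coefficient 1 of w^k in a F_w excludes a = 0. *)
- move=> a0; have := Qk (w_pow n k).
  rewrite eqxx /w_pow mulmnE mnm1E eqxx mul1n a0 => /(_ erefl) /eqP.
  by rewrite [_ * _]mul0r ps0 eq_sym oner_eq0.
- by apply/eqP; exact: oner_neq0.
by move=> i; exact: mul1r.
Qed.
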